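(* Let $\{t_s\}_{s=0}^\infty\subset\mathbb{Q}$ be absolutely summable with $t_0\in\mathbb{R}$, put $t_{-s}=\overline{t_s}$ for $s>0$, and for $n\in\mathbb{N}^+$ let $T_n=[t_{j-l}]_{j,l=1}^n$ be the corresponding Hermitian quaternion Toeplitz matrix, with Strang circulant preconditioner $c(T_n)$ and generating function $$f(x)=t_0+\sum_{s=1}^{+\infty}\Big(t_s\exp(\mathtt{p}sx)+\overline{t_s}\exp(-\mathtt{p}sx)\Big),\quad x\in[-\pi,\pi].$$ Suppose that $\check f$ is a positive function on $[-\pi,\pi]$. Then for any $\epsilon\in(0,1)$ there exist a constant $C(\epsilon)>0$ and a positive integer $n_0$ such that for all $n>n_0$, the preconditioned conjugate gradient (PCG) solver with preconditioner $c(T_n)$ for solving the Hermitian positive definite quaternion system $T_n\mathbf{u}=\mathbf{b}$ ($\mathbf{b}\in\mathbb{Q}^{n\times1}$) admits the error estimate $$\|\mathbf{e}^{(k)}\|_{T_n}\le C(\epsilon)\,\epsilon^{k-4n_0}\,\|\mathbf{e}^{(0)}\|_{T_n},\qquad k\ge4n_0,$$ where $\mathbf{e}^{(k)}:=\mathbf{u}^{(k)}-\mathbf{u}$, $\mathbf{u}^{(k)}$ ($k\ge1$) is the $k$-th PCG iterate, $\mathbf{u}^{(0)}\in\mathbb{Q}^{n\times1}$ is the initial guess and $\mathbf{u}$ is the exact solution of $T_n\mathbf{u}=\mathbf{b}$.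
   Context: $\mathbb{Q}$ denotes the real quaternions. A quaternion is pure if its real part is zero. $(\mathtt{p},\mathtt{q},\mathtt{r})$ is a fixed triple of pure unit quaternions, pairwise orthogonal (in $\mathbb{R}^4$), used as an imaginary system like $(\mathtt{i},\mathtt{j},\mathtt{k})$, so $\mathtt{p}^2=\mathtt{q}^2=\mathtt{r}^2=-1$, $\mathtt{p}\mathtt{q}=-\mathtt{q}\mathtt{p}=\mathtt{r}$, $\mathtt{q}\mathtt{r}=-\mathtt{r}\mathtt{q}=\mathtt{p}$, $\mathtt{r}\mathtt{p}=-\mathtt{p}\mathtt{r}=\mathtt{q}$. The bar denotes quaternion conjugation, $*$ the conjugate transpose, $|\cdot|$ the quaternion modulus. $\exp(\mathtt{p}x):=\cos x+\mathtt{p}\sin x$. Every $a=a_0+a_1\mathtt{p}+a_2\mathtt{q}+a_3\mathtt{r}$ ($a_i\in\mathbb{R}$) is uniquely $a=\phi_1(a)+\phi_2(a)\mathtt{q}$ with $\phi_1(a):=a_0+a_1\mathtt{p}$, $\phi_2(a):=a_2+a_3\mathtt{p}$. $\Phi_l[f](x):=\phi_l(f(x))$, $l=1,2$ ($\Phi_1[f]$ is real-valued for the generating function $f(x)=t_0+\sum_{s=1}^{+\infty}\big(t_s\exp(\mathtt{p}sx)+\overline{t_s}\exp(-\mathtt{p}sx)\big)$, $x\in[-\pi,\pi]$, where $\{t_s\}_{s=0}^\infty\subset\mathbb{Q}$ is absolutely summable and $t_0\in\mathbb{R}$), and $$\check f(x):=\tfrac12\Big[\Phi_1[f](x)+\Phi_1[f](-x)-\sqrt{|\Phi_1[f](x)-\Phi_1[f](-x)|^2+4|\Phi_2[f](x)|^2}\Big].$$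 Circulant matrices: for $\mathbf{v}=(c_0,\dots,c_{n-1})^{\rm T}$, $\mathcal{C}(\mathbf{v})$ is the $n\times n$ circulant matrix with first column $\mathbf{v}$, i.e. $(j,l)$ entry $c_{(j-l)\bmod n}$. The Strang circulant preconditioner is $c(T_n):=\mathcal{C}(\mathbf{v}_S(T_n))$, where $\mathbf{v}_S(T_n)=(t_0,t_1,\dots,t_{\lfloor(n-1)/2\rfloor},t_{-\lfloor(n-1)/2\rfloor},\dots,t_{-2},t_{-1})^{\rm T}$ if $n$ is odd, and $\mathbf{v}_S(T_n)=(t_0,t_1,\dots,t_{\lfloor(n-1)/2\rfloor},0,t_{-\lfloor(n-1)/2\rfloor},\dots,t_{-2},t_{-1})^{\rm T}$ if $n$ is even. A Hermitian $A\in\mathbb{Q}^{n\times n}$ is Hermitian positive definite (HPD) if $\mathbf{x}^*A\mathbf{x}>0$ for all nonzero $\mathbf{x}\in\mathbb{Q}^{n\times1}$; for HPD $A$, $\|\mathbf{x}\|_A:=(\mathbf{x}^*A\mathbf{x})^{1/2}$. PCG with HPD preconditioner $P$ for an HPD system $A\mathbf{u}=\mathbf{b}$ over $\mathbb{Q}$ is the standard algorithm: $\mathbf{r}_0=\mathbf{b}-A\mathbf{u}^{(0)}$, $\mathbf{p}_0=P^{-1}\mathbf{r}_0$, and for $k=0,1,2,\dots$ while $\mathbf{r}_k\ne0$: $\alpha_k=\dfrac{\mathbf{r}_k^*P^{-1}\mathbf{r}_k}{\mathbf{p}_k^*A\mathbf{p}_k}$, $\mathbf{u}^{(k+1)}=\mathbf{u}^{(k)}+\alpha_k\mathbf{p}_k$,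 $\mathbf{r}_{k+1}=\mathbf{r}_k-\alpha_kA\mathbf{p}_k$, $\beta_k=\dfrac{\mathbf{r}_{k+1}^*P^{-1}\mathbf{r}_{k+1}}{\mathbf{r}_k^*P^{-1}\mathbf{r}_k}$, $\mathbf{p}_{k+1}=P^{-1}\mathbf{r}_{k+1}+\beta_k\mathbf{p}_k$ (all $\alpha_k,\beta_k$ are real). If $\mathbf{r}_k=0$ the iterates are constant from step $k$ on. Here $A=T_n$ and $P=c(T_n)$ ($n_0$ is such that $c(T_n)$ is HPD, so that PCG is well defined, for $n>n_0$). *)

(* Defs.v *)
From HB Require Import structures.
From mathcomp Require Import all_boot all_order all_algebra.
From mathcomp Require Import ring lra.
From mathcomp Require Import all_classical all_reals all_analysis.
Set Implicit Arguments.
Unset Strict Implicit.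
Unset Printing Implicit Defensive.
Import Order.TTheory GRing.Theory Num.Theory.
Import numFieldNormedType.Exports.
Local Open Scope ring_scope.

Record quat (R : realType) : Type := Quat { q0 : R; q1 : R; q2 : R; q3 : R }.

Definition quat_tuple (R : realType) (a : quat R) : R * R * R * R :=
  (q0 a, q1 a, q2 a, q3 a).
Definition tuple_quat (R : realType) (x : R * R * R * R) : quat R :=
  Quat x.1.1.1 x.1.1.2 x.1.2 x.2.

Lemma quat_tupleK (R : realType) : cancel (@quat_tuple R) (@tuple_quat R).
Proof. by case. Qed.

Lemma quatP (R : realType) (a b : quat R) :
  q0 a = q0 b -> q1 a = q1 b -> q2 a = q2 b -> q3 a = q3 b -> a = b.
Proof. by case: a => a0 a1 a2 a3; case: b => b0 b1 b2 b3 /= -> -> -> ->. Qed.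

Definition addq (R : realType) (a b : quat R) : quat R :=
  Quat (q0 a + q0 b) (q1 a + q1 b) (q2 a + q2 b) (q3 a + q3 b).
Definition oppq (R : realType) (a : quat R) : quat R :=
  Quat (- q0 a) (- q1 a) (- q2 a) (- q3 a).
Definition mulq (R : realType) (a b : quat R) : quat R :=
  Quat (q0 a * q0 b - q1 a * q1 b - q2 a * q2 b - q3 a * q3 b)
       (q0 a * q1 b + q1 a * q0 b + q2 a * q3 b - q3 a * q2 b)
       (q0 a * q2 b - q1 a * q3 b + q2 a * q0 b + q3 a * q1 b)
       (q0 a * q3 b + q1 a * q2 b - q2 a * q1 b + q3 a * q0 b).
Definition qreal (R : realType) (x : R) : quat R := Quat x 0 0 0.

HB.instance Definition _ (R : realType) :=
  Choice.copy (quat R) (can_type (@quat_tupleK R)).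

Lemma addqA (R : realType) : associative (@addq R).
Proof. by move=> a b c; apply: quatP => /=; ring. Qed.
Lemma addqC (R : realType) : commutative (@addq R).
Proof. by move=> a b; apply: quatP => /=; ring. Qed.
Lemma add0q (R : realType) : left_id (qreal (0 : R)) (@addq R).
Proof. by move=> a; apply: quatP => /=; ring. Qed.
Lemma addNq (R : realType) : left_inverse (qreal (0 : R)) (@oppq R) (@addq R).
Proof. by move=> a; apply: quatP => /=; ring. Qed.

HB.instance Definition _ (R : realType) :=
  GRing.isZmodule.Build (quat R)
    (@addqA R) (@addqC R) (@add0q R) (@addNq R).

Lemma mulqA (R : realType) : associative (@mulq R).
Proof. by move=> a b c; apply: quatP => /=; ring. Qed.
Lemma mul1q (R : realType) : left_id (qreal (1 : R)) (@mulq R).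
Proof. by move=> a; apply: quatP => /=; ring. Qed.
Lemma mulq1 (R : realType) : right_id (qreal (1 : R)) (@mulq R).
Proof. by move=> a; apply: quatP => /=; ring. Qed.
Lemma mulqDl (R : realType) : left_distributive (@mulq R) +%R.
Proof. by move=> a b c; apply: quatP => /=; ring. Qed.
Lemma mulqDr (R : realType) : right_distributive (@mulq R) +%R.
Proof. by move=> a b c; apply: quatP => /=; ring. Qed.
Lemma oneq_neq0 (R : realType) : qreal (1 : R) != 0.
Proof. by apply/eqP => -[] /eqP; rewrite oner_eq0. Qed.

HB.instance Definition _ (R : realType) :=
  GRing.Zmodule_isNzRing.Build (quat R)
    (@mulqA R) (@mul1q R) (@mulq1 R) (@mulqDl R) (@mulqDr R) (@oneq_neq0 R).

Definition conjq (R : realType) (a : quat R) : quat R :=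
  Quat (q0 a) (- q1 a) (- q2 a) (- q3 a).

(* Euclidean inner product of R^4. *)
Definition dotq (R : realType) (a b : quat R) : R :=
  q0 a * q0 b + q1 a * q1 b + q2 a * q2 b + q3 a * q3 b.

Definition normq (R : realType) (a : quat R) : R := Num.sqrt (dotq a a).

Definition is_realq (R : realType) (a : quat R) : Prop := a = qreal (q0 a).

(* p * q = r only fixes the orientation (orthonormality alone gives
   p * q = r or p * q = - r); see imag_system_table for the rest of the
   multiplication table. *)
Record imag_system (R : realType) (p q r : quat R) : Prop := ImagSystem {
  imag_pure : [/\ q0 p = 0, q0 q = 0 & q0 r = 0];
  imag_unit : [/\ normq p = 1, normq q = 1 & normq r = 1];
  imag_orth : [/\ dotq p q = 0, dotq q r = 0 & dotq r p = 0];
  imag_mul : p * q = r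
}.

Lemma quat0E (R : realType) : 0 = qreal 0 :> quat R. Proof. by []. Qed.
Lemma quat1E (R : realType) : 1 = qreal 1 :> quat R. Proof. by []. Qed.

Lemma conjqM (R : realType) (a b : quat R) :
  conjq (a * b) = conjq b * conjq a.
Proof. by apply: quatP => /=; ring. Qed.

Lemma conjqK (R : realType) : involutive (@conjq R).
Proof. by move=> a; apply: quatP; rewrite /= ?opprK. Qed.

Lemma conjq_pure (R : realType) (a : quat R) : q0 a = 0 -> conjq a = - a.
Proof. by move=> a0; apply: quatP => //=; rewrite a0 oppr0. Qed.

Lemma normq_eq1 (R : realType) (a : quat R) : normq a = 1 -> dotq a a = 1.
Proof.
move=> a1; rewrite -[LHS]sqr_sqrtr -/(normq a) ?a1 ?expr1n //.
by rewrite /dotq -!expr2 !addr_ge0 ?sqr_ge0.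
Qed.

Lemma pure_unit_sqr (R : realType) (a : quat R) :
  q0 a = 0 -> normq a = 1 -> a * a = -1.
Proof.
move=> a0 /normq_eq1; rewrite /dotq => a1.
have -> : -1 = qreal (- dotq a a) by rewrite /dotq a1; apply: quatP; rewrite /= ?oppr0.
by apply: quatP => /=; rewrite ?/dotq a0; lra.
Qed.

Lemma imag_system_table (R : realType) (p q r : quat R) :
  imag_system p q r ->
  [/\ p * p = -1, q * q = -1 & r * r = -1] /\
  [/\ p * q = r, q * r = p & r * p = q] /\
  [/\ q * p = - r, r * q = - p & p * r = - q].
Proof.
case=> -[p0 q0' r0] [p1 q1' r1] _ pq.
have pp := pure_unit_sqr p0 p1; have qq := pure_unit_sqr q0' q1'.
have rr := pure_unit_sqr r0 r1.
have qp : q * p = - r.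
  have /= := congr1 (@conjq R) pq.
  by rewrite conjqM !conjq_pure // mulrNN.
have rq : r * q = - p by rewrite -pq -mulrA qq mulrN1.
have pr : p * r = - q by rewrite -pq mulrA pp mulN1r.
have qr : q * r = p by rewrite -[r]opprK -qp mulrN mulrA qq mulN1r opprK.
have rp : r * p = q by rewrite -[r]opprK -qp mulNr -mulrA pp mulrN1 opprK.
by do !split.
Qed.

(* Coordinates in the orthonormal basis (1, p, q, r) are inner products;
   see phi1_coord, phi2_coord. *)
Definition phi1 (R : realType) (p a : quat R) : quat R :=
  qreal (q0 a) + qreal (dotq a p) * p.
Definition phi2 (R : realType) (p q r a : quat R) : quat R :=
  qreal (dotq a q) + qreal (dotq a r) * p.

Lemma phi1_coord (R : realType) (p q r : quat R) (a0 a1 a2 a3 : R) :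
  imag_system p q r ->
  phi1 p (qreal a0 + qreal a1 * p + qreal a2 * q + qreal a3 * r) =
  qreal a0 + qreal a1 * p.
Proof.
case=> -[p0 q0' r0] [/normq_eq1 p1 /normq_eq1 q1' /normq_eq1 r1] [pq qr rp] _.
rewrite /phi1; congr (_ + _ * _).
  by congr qreal; rewrite /= p0 q0' r0; ring.
congr qreal; transitivity (a1 * dotq p p + a2 * dotq p q + a3 * dotq r p).
  by rewrite /dotq /= p0 q0' r0; ring.
by rewrite p1 pq rp; ring.
Qed.

Lemma phi2_coord (R : realType) (p q r : quat R) (a0 a1 a2 a3 : R) :
  imag_system p q r ->
  phi2 p q r (qreal a0 + qreal a1 * p + qreal a2 * q + qreal a3 * r) =
  qreal a2 + qreal a3 * p.
Proof.
case=> -[p0 q0' r0] [/normq_eq1 p1 /normq_eq1 q1' /normq_eq1 r1] [pq qr rp] _.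
rewrite /phi2; congr (qreal _ + qreal _ * _).
  transitivity (a1 * dotq p q + a2 * dotq q q + a3 * dotq q r).
    by rewrite /dotq /= p0 q0' r0; ring.
  by rewrite pq q1' qr; ring.
transitivity (a1 * dotq r p + a2 * dotq q r + a3 * dotq r r).
  by rewrite /dotq /= p0 q0' r0; ring.
by rewrite rp qr r1; ring.
Qed.

Definition qexp (R : realType) (p : quat R) (x : R) : quat R :=
  qreal (cos x) + p * qreal (sin x).

(* Sum of a series in R^4, taken coordinatewise. *)
Definition qseries_sum (R : realType) (u : nat -> quat R) : quat R :=
  Quat (limn (series (fun s => q0 (u s)))) (limn (series (fun s => q1 (u s))))
       (limn (series (fun s => q2 (u s)))) (limn (series (fun s => q3 (u s)))).

Definition abs_summable (R : realType) (t : nat -> quat R) : Prop :=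
  cvgn (series (fun s => normq (t s))).

(* The index s of the series below stands for s + 1 in the usual formula
   (summation over s >= 1). *)
Definition gen_fun (R : realType) (p : quat R) (t : nat -> quat R) (x : R)
    : quat R :=
  t 0%N + qseries_sum (fun s => t s.+1 * qexp p (s.+1%:R * x)
                              + conjq (t s.+1) * qexp p (- (s.+1%:R * x))).

(* The phi1 part of a generating function is real-valued, whence the two
   occurrences of q0. *)
Definition check_fun (R : realType) (p q r : quat R) (f : R -> quat R) (x : R)
    : R :=
  2^-1 * (q0 (phi1 p (f x)) + q0 (phi1 p (f (- x)))
          - Num.sqrt (normq (phi1 p (f x) - phi1 p (f (- x))) ^+ 2
                      + 4 * normq (phi2 p q r (f x)) ^+ 2)).

Definition ext_seq (R : realType) (t : nat -> quat R) (s : int) : quat R :=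
  match s with Posz m => t m | Negz m => conjq (t m.+1) end.

Definition toeplitz (R : realType) (t : nat -> quat R) (n : nat)
    : 'M[quat R]_n :=
  \matrix_(j < n, l < n) ext_seq t (j%:Z - l%:Z).

Lemma circ_index_subproof (n : nat) (j l : 'I_n) : ((j + (n - l)) %% n < n)%N.
Proof. by rewrite ltn_pmod // (leq_ltn_trans (leq0n j)). Qed.

(* (j - l) mod n, avoiding truncated subtraction. *)
Definition circ_index (n : nat) (j l : 'I_n) : 'I_n :=
  Ordinal (circ_index_subproof j l).

Definition circulant (R : realType) (n : nat) (v : 'cV[quat R]_n)
    : 'M[quat R]_n :=
  \matrix_(j < n, l < n) v (circ_index j l) 0.

Definition strang_vec (R : realType) (t : nat -> quat R) (n : nat)
    : 'cV[quat R]_n :=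
  \col_(m < n) if (m <= (n.-1)./2)%N then ext_seq t m%:Z
               else if ~~ odd n && (m == (n.-1)./2.+1 :> nat) then 0
               else ext_seq t (m%:Z - n%:Z).

Definition strang (R : realType) (t : nat -> quat R) (n : nat) : 'M[quat R]_n :=
  circulant (strang_vec t n).

Definition adjq (R : realType) (m n : nat) (A : 'M[quat R]_(m, n))
    : 'M[quat R]_(n, m) :=
  \matrix_(i < n, j < m) conjq (A j i).

(* x^* A x, a 1 x 1 matrix identified with its entry. *)
Definition qform (R : realType) (n : nat) (A : 'M[quat R]_n) (x : 'cV[quat R]_n)
    : quat R :=
  (adjq x *m A *m x) 0 0.

Definition hermitianq (R : realType) (n : nat) (A : 'M[quat R]_n) : Prop :=
  adjq A = A.

Lemma conjq_sum (R : realType) (I : finType) (F : I -> quat R) :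
  conjq (\sum_i F i) = \sum_i conjq (F i).
Proof.
apply: (big_morph (@conjq R)); last by apply: quatP; rewrite /= ?oppr0.
by move=> a b; apply: quatP => /=; ring.
Qed.

Lemma adjqM (R : realType) (m n l : nat)
    (A : 'M[quat R]_(m, n)) (B : 'M[quat R]_(n, l)) :
  adjq (A *m B) = adjq B *m adjq A.
Proof.
apply/matrixP => i j; rewrite !mxE conjq_sum.
by apply: eq_bigr => k _; rewrite conjqM !mxE.
Qed.

Lemma adjqK (R : realType) (m n : nat) (A : 'M[quat R]_(m, n)) :
  adjq (adjq A) = A.
Proof. by apply/matrixP => i j; rewrite !mxE conjqK. Qed.

Lemma qform_real (R : realType) (n : nat) (A : 'M[quat R]_n)
    (x : 'cV[quat R]_n) :
  hermitianq A -> is_realq (qform A x).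
Proof.
move=> hA.
have : conjq (qform A x) = qform A x.
  transitivity ((adjq (adjq x *m A *m x)) 0 0); first by rewrite mxE.
  by rewrite !adjqM adjqK hA mulmxA.
case: (qform A x) => a0 a1 a2 a3 -[h1 h2 h3].
by apply: quatP => //=; lra.
Qed.

(* The quadratic form of a Hermitian matrix is real-valued (qform_real), so
   its positivity is that of q0. *)
Definition hpd (R : realType) (n : nat) (A : 'M[quat R]_n) : Prop :=
  hermitianq A /\ forall x : 'cV[quat R]_n, x != 0 -> 0 < q0 (qform A x).

Definition normA (R : realType) (n : nat) (A : 'M[quat R]_n)
    (x : 'cV[quat R]_n) : R :=
  Num.sqrt (q0 (qform A x)).

(* invmx needs a commutative ring; the default value 0 is only taken on
   non-invertible matrices, in particular never on an hpd one. *)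
Definition invmxq (R : realType) (n : nat) (A : 'M[quat R]_n) : 'M[quat R]_n :=
  xget 0 [set B : 'M[quat R]_n | A *m B = 1%:M /\ B *m A = 1%:M]%classic.

Record pcg_state (R : realType) (n : nat) : Type := PCGState {
  pcg_u : 'cV[quat R]_n;
  pcg_r : 'cV[quat R]_n;
  pcg_p : 'cV[quat R]_n
}.

Definition pcg_init (R : realType) (n : nat) (A P : 'M[quat R]_n)
    (b u0 : 'cV[quat R]_n) : pcg_state R n :=
  let r0 := b - A *m u0 in PCGState u0 r0 (invmxq P *m r0).

(* The step lengths are quotients of values of quadratic forms of Hermitian
   matrices, hence real; real scalars commute with all quaternions, so it does
   not matter that *: multiplies on the left. *)
Definition pcg_step (R : realType) (n : nat) (A P : 'M[quat R]_n)
    (S : pcg_state R n) : pcg_state R n :=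
  let r := pcg_r S in
  let p := pcg_p S in
  if r == 0 then S else
  let alpha := q0 (qform (invmxq P) r) / q0 (qform A p) in
  let u' := pcg_u S + qreal alpha *: p in
  let r' := r - qreal alpha *: (A *m p) in
  let beta := q0 (qform (invmxq P) r') / q0 (qform (invmxq P) r) in
  PCGState u' r' (invmxq P *m r' + qreal beta *: p).

Definition pcg_iter (R : realType) (n : nat) (A P : 'M[quat R]_n)
    (b u0 : 'cV[quat R]_n) (k : nat) : 'cV[quat R]_n :=
  pcg_u (iter k (pcg_step A P) (pcg_init A P b u0)).

(* Main.v *)
(* Positivity. The discrete Fourier transform with respect to the axis p splits
   the quadratic form of a circulant matrix into 2 x 2 blocks coupling the
   frequencies th and -th; for the Strang matrix the block at th is the Hermitian
   matrix whose smallest eigenvalue is check_fun, up to replacing the generating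
   function by a partial sum. As check_fun is continuous and positive on a compact
   interval, the forms of c(T_n) are bounded below uniformly in n, and so are those
   of T_n, which is a principal submatrix of c(T_(2n+1)).

   Clustering. On vectors vanishing in the first N coordinates, the forms of T_n
   and c(T_n) differ only through coefficients of rank >= N, hence by a small
   multiple of the norm. Diagonalizing the pencil (T_n, c(T_n)) in the complex
   representation of quaternion matrices, all but 4 N of its 2 n eigenvalues lie
   in [1 - eps, 1 + eps], and all of them in a fixed compact subset of ]0, +oo[.

   Convergence. PCG is the conjugate gradient method for the real inner product
   q0(x^* y), so its k-th error is at most that of q(P^-1 A) e_0 for any real
   polynomial q of degree <= k with q(0) = 1; take for q the product of the
   1 - x / d over the outlying eigenvalues d and of a power of 1 - x. *)

From mathcomp Require Import all_boot all_order all_algebra.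
From mathcomp Require Import ring lra zify complex.
From mathcomp Require Import all_classical all_reals all_analysis.
Require Import Defs.
Set Implicit Arguments.
Unset Strict Implicit.
Unset Printing Implicit Defensive.
Import Order.TTheory GRing.Theory Num.Theory.
Import numFieldNormedType.Exports.
Local Open Scope ring_scope.

(** * Real inner product on quaternion vectors *)

Lemma eq_ler (R : realType) (x y : R) : x = y -> x <= y.
Proof. by move=> ->. Qed.

Lemma qrealD (R : realType) (a b : R) : qreal (a + b) = qreal a + qreal b.
Proof. by apply: quatP => /=; ring. Qed.

Lemma qrealN (R : realType) (a : R) : qreal (- a) = - qreal a.
Proof. by apply: quatP => /=; ring. Qed.

Lemma qrealM (R : realType) (a b : R) : qreal (a * b) = qreal a * qreal b.
Proof. by apply: quatP => /=; ring. Qed.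

Lemma qrealC (R : realType) (a : R) (b : quat R) : qreal a * b = b * qreal a.
Proof. by apply: quatP => /=; ring. Qed.

Lemma q0D (R : realType) (a b : quat R) : q0 (a + b) = q0 a + q0 b.
Proof. by []. Qed.

Lemma q0B (R : realType) (a b : quat R) : q0 (a - b) = q0 a - q0 b.
Proof. by []. Qed.

Lemma q0_sum (R : realType) (I : Type) (s : seq I) (P : pred I) (F : I -> quat R) :
  q0 (\sum_(i <- s | P i) F i) = \sum_(i <- s | P i) q0 (F i).
Proof. exact: (big_morph (@q0 R)). Qed.

Lemma conjqD (R : realType) (a b : quat R) : conjq (a + b) = conjq a + conjq b.
Proof. by apply: quatP => /=; ring. Qed.

Lemma dotqE (R : realType) (a b : quat R) : dotq a b = q0 (conjq a * b).
Proof. by rewrite /dotq /=; ring. Qed.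

Lemma dotqC (R : realType) (a b : quat R) : dotq a b = dotq b a.
Proof. by rewrite /dotq; ring. Qed.

Lemma dot0q (R : realType) (a : quat R) : dotq 0 a = 0.
Proof. by rewrite /dotq /=; ring. Qed.

Lemma dotq_ge0 (R : realType) (a : quat R) : 0 <= dotq a a.
Proof. by rewrite /dotq -!expr2 !addr_ge0 ?sqr_ge0. Qed.

Lemma dotq_eq0 (R : realType) (a : quat R) : (dotq a a == 0) = (a == 0).
Proof.
apply/eqP/eqP => [|->]; last by rewrite /dotq /=; ring.
rewrite /dotq -!expr2 => h.
have [h0 h1 h2 h3] : [/\ q0 a ^+ 2 = 0, q1 a ^+ 2 = 0, q2 a ^+ 2 = 0 & q3 a ^+ 2 = 0].
  have := sqr_ge0 (q0 a); have := sqr_ge0 (q1 a).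
  have := sqr_ge0 (q2 a); have := sqr_ge0 (q3 a).
  by move=> *; split; lra.
by apply: quatP; apply/eqP; rewrite /= -sqrf_eq0; apply/eqP.
Qed.

Lemma normq_ge0 (R : realType) (a : quat R) : 0 <= normq a.
Proof. exact: sqrtr_ge0. Qed.

Lemma sqr_normq (R : realType) (a : quat R) : normq a ^+ 2 = dotq a a.
Proof. by rewrite sqr_sqrtr // dotq_ge0. Qed.

Lemma normqM (R : realType) (a b : quat R) : normq (a * b) = normq a * normq b.
Proof. by rewrite -sqrtrM ?dotq_ge0 //; congr Num.sqrt; rewrite /dotq /=; ring. Qed.

Lemma normq_conj (R : realType) (a : quat R) : normq (conjq a) = normq a.
Proof. by congr Num.sqrt; rewrite /dotq /=; ring. Qed.

Lemma normqN (R : realType) (a : quat R) : normq (- a) = normq a.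
Proof. by congr Num.sqrt; rewrite /dotq /=; ring. Qed.

Lemma normq_real (R : realType) (x : R) : normq (qreal x) = `|x|.
Proof. by rewrite -sqrtr_sqr; congr Num.sqrt; rewrite /dotq /=; ring. Qed.

Lemma normq0 (R : realType) : normq (0 : quat R) = 0.
Proof. by rewrite [LHS]normq_real normr0. Qed.

Lemma normr_q0 (R : realType) (a : quat R) : `|q0 a| <= normq a.
Proof.
rewrite -sqrtr_sqr ler_sqrt ?dotq_ge0 // /dotq -!expr2 -!addrA lerDl.
by rewrite !addr_ge0 ?sqr_ge0.
Qed.

Lemma normr_dotq (R : realType) (a b : quat R) : `|dotq a b| <= normq a * normq b.
Proof. by rewrite dotqE (le_trans (normr_q0 _)) // normqM normq_conj. Qed.

Lemma normqD (R : realType) (a b : quat R) : normq (a + b) <= normq a + normq b.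
Proof.
rewrite -ler_sqr ?nnegrE ?addr_ge0 ?normq_ge0 // sqrrD !sqr_normq.
have -> : dotq (a + b) (a + b) = dotq a a + 2 * dotq a b + dotq b b.
  by rewrite /dotq /=; ring.
have := le_trans (ler_norm _) (normr_dotq a b).
by rewrite mulr2n => ?; lra.
Qed.

(** The Euclidean product of the underlying real space, that is the real part of [x^* y]. Real
    scalars suffice for PCG because all its step lengths are real. *)
Definition dotv (R : realType) (n : nat) (x y : 'cV[quat R]_n) : R :=
  \sum_i dotq (x i 0) (y i 0).

Lemma dotvE (R : realType) (n : nat) (x y : 'cV[quat R]_n) :
  dotv x y = q0 ((adjq x *m y) 0 0).
Proof.
by rewrite mxE q0_sum; apply: eq_bigr => i _; rewrite mxE dotqE.
Qed.

Lemma q0_qform (R : realType) (n : nat) (A : 'M[quat R]_n) (x : 'cV[quat R]_n) :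
  q0 (qform A x) = dotv x (A *m x).
Proof. by rewrite dotvE mulmxA. Qed.

Lemma dotvC (R : realType) (n : nat) (x y : 'cV[quat R]_n) : dotv x y = dotv y x.
Proof. by apply: eq_bigr => i _; rewrite dotqC. Qed.

Lemma dotvDr (R : realType) (n : nat) (x y z : 'cV[quat R]_n) :
  dotv x (y + z) = dotv x y + dotv x z.
Proof.
by rewrite -big_split; apply: eq_bigr => i _; rewrite mxE /dotq /=; ring.
Qed.

Lemma dotvZr (R : realType) (n : nat) (a : R) (x y : 'cV[quat R]_n) :
  dotv x (qreal a *: y) = a * dotv x y.
Proof.
by rewrite mulr_sumr; apply: eq_bigr => i _; rewrite mxE /dotq /=; ring.
Qed.

Lemma dotvNr (R : realType) (n : nat) (x y : 'cV[quat R]_n) :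
  dotv x (- y) = - dotv x y.
Proof.
by rewrite -sumrN; apply: eq_bigr => i _; rewrite mxE /dotq /=; ring.
Qed.

Lemma dotvBr (R : realType) (n : nat) (x y z : 'cV[quat R]_n) :
  dotv x (y - z) = dotv x y - dotv x z.
Proof. by rewrite dotvDr dotvNr. Qed.

Lemma dotvDl (R : realType) (n : nat) (x y z : 'cV[quat R]_n) :
  dotv (x + y) z = dotv x z + dotv y z.
Proof. by rewrite !(dotvC _ z) dotvDr. Qed.

Lemma dotvBl (R : realType) (n : nat) (x y z : 'cV[quat R]_n) :
  dotv (x - y) z = dotv x z - dotv y z.
Proof. by rewrite !(dotvC _ z) dotvBr. Qed.

Lemma dotvZl (R : realType) (n : nat) (a : R) (x y : 'cV[quat R]_n) :
  dotv (qreal a *: x) y = a * dotv x y.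
Proof. by rewrite !(dotvC _ y) dotvZr. Qed.

Lemma dotv_ge0 (R : realType) (n : nat) (x : 'cV[quat R]_n) : 0 <= dotv x x.
Proof. by apply: sumr_ge0 => i _; exact: dotq_ge0. Qed.

Lemma dotv_gt0 (R : realType) (n : nat) (x : 'cV[quat R]_n) :
  x != 0 -> 0 < dotv x x.
Proof.
move=> x0; rewrite lt_neqAle dotv_ge0 andbT eq_sym; apply: contra x0 => /eqP h.
apply/eqP/colP => i; rewrite mxE; apply/eqP; rewrite -dotq_eq0; apply/eqP.
exact: (psumr_eq0P (fun j _ => dotq_ge0 (x j 0)) h).
Qed.

Lemma dotv_mulmxl (R : realType) (m n : nat) (A : 'M[quat R]_(m, n)) x y :
  dotv (A *m x) y = dotv x (adjq A *m y).
Proof. by rewrite !dotvE adjqM mulmxA. Qed.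

(** Entries do not commute; a scalar can be pulled through a product on this side because it is
    real, hence central. *)
Lemma mulmx_scaleqr (R : realType) (m n k : nat) (A : 'M[quat R]_(m, n))
    (a : R) (B : 'M[quat R]_(n, k)) :
  A *m (qreal a *: B) = qreal a *: (A *m B).
Proof.
apply/matrixP => i j; rewrite !mxE mulr_sumr; apply: eq_bigr => l _.
by rewrite mxE !mulrA qrealC.
Qed.

(** * Optimality of PCG *)

Section PCG.
Variables (R : realType) (n : nat) (A P Q : 'M[quat R]_n) (b u0 u : 'cV[quat R]_n).
Hypotheses (hA : hpd A) (hP : hpd P) (QE : invmxq P = Q).
Hypotheses (PQ : P *m Q = 1%:M) (QP : Q *m P = 1%:M) (Au : A *m u = b).

Let st k := iter k (pcg_step A P) (pcg_init A P b u0).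
Let U k := pcg_u (st k).
Let r k := pcg_r (st k).
Let p k := pcg_p (st k).
Let z k := Q *m r k.
Let rz k := dotv (r k) (z k).
Let alpha k := rz k / dotv (p k) (A *m p k).

Lemma hpd_dotvC (M : 'M[quat R]_n) x y : hpd M -> dotv x (M *m y) = dotv (M *m x) y.
Proof. by move=> [hM _]; rewrite dotv_mulmxl hM. Qed.

Lemma hpd_dotv_gt0 (M : 'M[quat R]_n) x : hpd M -> x != 0 -> 0 < dotv x (M *m x).
Proof. by move=> [_ hM] /hM; rewrite q0_qform. Qed.

Lemma hpd_dotv_ge0 (M : 'M[quat R]_n) x : hpd M -> 0 <= dotv x (M *m x).
Proof.
move=> hM; have [->|x0] := eqVneq x 0; last exact/ltW/hpd_dotv_gt0.
by rewrite mulmx0 dotvE mulmx0 mxE.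
Qed.

Lemma hpd_pythagoras (M : 'M[quat R]_n) d e : hpd M -> dotv d (M *m e) = 0 ->
  dotv e (M *m e) <= dotv (d + e) (M *m (d + e)).
Proof.
move=> hM h0; rewrite mulmxDr dotvDl !dotvDr h0 addr0.
rewrite (hpd_dotvC e d hM) (dotvC _ d) h0 add0r lerDr.
exact: hpd_dotv_ge0.
Qed.

(** The adjoint of [Q] is also a left inverse of [P], so it equals [Q]; the form of [Q] at [x] is
    that of [P] at [Q *m x]. *)
Lemma hpd_inverse : hpd Q.
Proof.
have hQ : adjq Q = Q.
  have h : adjq Q *m P = 1%:M.
    have [hP1 _] := hP; rewrite -{1}hP1 -adjqM PQ.
    apply/matrixP => i j; rewrite !mxE eq_sym.
    by case: (_ == _); apply: quatP; rewrite /= ?oppr0.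
  by rewrite -[adjq Q]mulmx1 -PQ mulmxA h mul1mx.
split=> // x x0; rewrite q0_qform.
have y0 : Q *m x != 0.
  by apply: contra x0 => /eqP h; rewrite -[x]mul1mx -PQ -mulmxA h mulmx0.
have := hpd_dotv_gt0 hP y0.
by rewrite mulmxA PQ mul1mx dotvC.
Qed.

Let hQ := hpd_inverse.

Lemma pcg_step_eq k : r k != 0 ->
  [/\ U k.+1 = U k + qreal (alpha k) *: p k,
      r k.+1 = r k - qreal (alpha k) *: (A *m p k) &
      p k.+1 = z k.+1 + qreal (rz k.+1 / rz k) *: p k].
Proof.
move=> rk0; have rS : (pcg_r (st k) == 0) = false := negbTE rk0.
rewrite /rz /alpha /rz /z /r /p /U /st iterS -/(st k) /pcg_step rS /=.
rewrite QE !q0_qform.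
by split.
Qed.

Lemma p0E : p 0 = z 0.
Proof. by rewrite /p /z /r /= QE. Qed.

Lemma pcg_stationary k : r k = 0 -> st k.+1 = st k.
Proof. by rewrite /r /st iterS /pcg_step => ->; rewrite eqxx. Qed.

Lemma residual_neq0 j k : (j <= k)%N -> r k != 0 -> r j != 0.
Proof.
move=> jk; apply: contra => /eqP rj; apply/eqP.
elim: k jk => [|k IH]; first by rewrite leqn0 => /eqP j0; rewrite j0 in rj.
rewrite leq_eqVlt => /orP[/eqP jk|]; first by rewrite jk in rj.
rewrite ltnS => /IH rk.
by rewrite /r pcg_stationary.
Qed.

(** Makes the recursively updated residual usable as [- A] times the error. *)
Lemma pcg_residual k : r k = b - A *m U k.
Proof.
elim: k => [//|k IH]; have [r0|rk0] := eqVneq (r k) 0.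
  by rewrite /U /r pcg_stationary.
have [-> -> _] := pcg_step_eq rk0.
by rewrite mulmxDr mulmx_scaleqr IH opprD addrA.
Qed.

Lemma rz_gt0 k : r k != 0 -> 0 < rz k.
Proof. by move=> rk; apply: hpd_dotv_gt0. Qed.

(** The classical conjugate gradient relations, bundled because their proofs by induction feed each
    other. *)
Definition pcg_invariant k :=
  [/\ dotv (p k) (r k) = rz k,
      forall j, (j < k)%N -> dotv (p j) (r k) = 0,
      forall j, (j < k)%N -> dotv (r j) (z k) = 0 &
      forall j, (j < k)%N -> dotv (A *m p j) (p k) = 0].

Lemma alpha_gt0 k : r k != 0 -> dotv (p k) (r k) = rz k ->
  0 < dotv (p k) (A *m p k) /\ 0 < alpha k.
Proof.
move=> rk pr; have pk : p k != 0.
  apply/eqP => pk; have := rz_gt0 rk; rewrite -pr pk dotvC dotvE mulmx0 mxE.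
  by rewrite ltxx.
by have h := hpd_dotv_gt0 hA pk; split=> //; rewrite divr_gt0 // rz_gt0.
Qed.

Lemma pcg_invariantP k : r k != 0 -> pcg_invariant k.
Proof.
elim/ltn_ind: k => -[|k] IH rk1.
  by split=> //; rewrite p0E dotvC.
have inv j : (j <= k)%N -> pcg_invariant j.
  by move=> jk; apply: IH => //; apply: residual_neq0 rk1; apply: leqW.
have rN0 j : (j <= k)%N -> r j != 0.
  by move=> jk; apply: residual_neq0 rk1; apply: leqW.
have [pr2 pr rz0 pA] := inv k (leqnn _).
have [pAp_gt0 a_gt0] := alpha_gt0 (rN0 _ (leqnn k)) pr2.
have [_ rS pS] := pcg_step_eq (rN0 _ (leqnn k)).
(* For [j = k] this is the choice of [alpha k]; for [j < k] it follows from conjugacy of the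
   directions. *)
have prS j : (j < k.+1)%N -> dotv (p j) (r k.+1) = 0.
  rewrite ltnS leq_eqVlt => /orP[/eqP -> | jk]; rewrite rS dotvBr dotvZr.
    by rewrite pr2 divfK ?subrr // gt_eqF.
  by rewrite (pr _ jk) hpd_dotvC // (pA _ jk) mulr0 subrr.
(* [z j] is a combination of [p j] and the previous direction, both orthogonal to the new
   residual. *)
have zrS j : (j < k.+1)%N -> dotv (r j) (z k.+1) = 0.
  move=> jk; rewrite /z hpd_dotvC // -/(z j).
  case: j jk => [|j] jk; first by rewrite -p0E; exact: prS.
  have [_ _ pj] := pcg_step_eq (rN0 j (ltnW jk)).
  have -> : z j.+1 = p j.+1 - qreal (rz j.+1 / rz j) *: p j by rewrite pj addrK.
  by rewrite dotvBl dotvZl !prS ?mulr0 ?subr0 // (leq_trans (leqnSn _)).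
split=> // [|j jk].
  by rewrite pS dotvDl dotvZl prS // mulr0 addr0 dotvC.
have rNj : r j != 0 by apply: rN0.
have [_ aj] := alpha_gt0 rNj (let: And4 h _ _ _ := inv j jk in h).
have [_ rj _] := pcg_step_eq rNj.
(* Solving the residual update for [A *m p j] turns conjugacy of directions into orthogonality of
   residuals. *)
have Apj : A *m p j = qreal (alpha j)^-1 *: (r j - r j.+1).
  rewrite rj opprB addrC subrK scalerA -qrealM mulVf ?scale1r //.
  by rewrite gt_eqF.
rewrite pS dotvDr dotvZr; move: jk; rewrite ltnS leq_eqVlt => /orP[/eqP jk|jk].
  (* For [j = k] the coefficient [rz k.+1 / rz k] is exactly the one that cancels the remaining
     term. *)
  rewrite jk in Apj *.
  have -> : dotv (A *m p k) (z k.+1) = (alpha k)^-1 * - rz k.+1.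
    by rewrite Apj dotvZl dotvBl zrS // sub0r.
  rewrite (dotvC (A *m p k)) /alpha invf_div.
  have h1 : rz k != 0 by rewrite gt_eqF // rz_gt0 // rN0.
  have h2 : dotv (p k) (A *m p k) != 0 by rewrite gt_eqF.
  by field.
rewrite (pA _ jk) mulr0 addr0 Apj dotvZl dotvBl !zrS ?ltnS ?(ltnW jk) //.
by rewrite subrr mulr0.
Qed.

(* The bipolar description of span(p_0, ..., p_(k-1)); it makes closure
   properties immediate. *)
Definition krylov k (x : 'cV[quat R]_n) :=
  forall y, (forall j, (j < k)%N -> dotv (p j) y = 0) -> dotv x y = 0.

Lemma krylovD k x y : krylov k x -> krylov k y -> krylov k (x + y).
Proof. by move=> hx hy w hw; rewrite dotvDl hx // hy // addr0. Qed.

Lemma krylovZ k a x : krylov k x -> krylov k (qreal a *: x).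
Proof. by move=> hx w hw; rewrite dotvZl hx // mulr0. Qed.

Lemma krylovB k x y : krylov k x -> krylov k y -> krylov k (x - y).
Proof. by move=> hx hy w hw; rewrite dotvBl hx // hy // subr0. Qed.

Lemma krylov_p j k : (j < k)%N -> krylov k (p j).
Proof. by move=> jk w; apply. Qed.

Lemma krylovW j k x : (j <= k)%N -> krylov j x -> krylov k x.
Proof.
by move=> jk hx w hw; apply: hx => i ij; apply: hw; apply: leq_trans ij jk.
Qed.

Lemma krylov_z j : r j != 0 -> krylov j.+1 (z j).
Proof.
case: j => [|j] rj; first by rewrite -p0E; exact: krylov_p.
have [_ _ pj] := pcg_step_eq (residual_neq0 (leqnSn j) rj).
have -> : z j.+1 = p j.+1 - qreal (rz j.+1 / rz j) *: p j by rewrite pj addrK.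
by apply: krylovB; [exact: krylov_p | apply/krylovZ/krylov_p].
Qed.

(** [Q A p_i] is a multiple of [z_i - z_(i+1)], so each application of [Q A] costs one more
    direction. Self-adjointness of [Q] and [A] moves them onto the test vector and back; [r k != 0]
    keeps the [alpha i] invertible. *)
Lemma krylovQA j k x : (j < k)%N -> r k != 0 ->
  krylov j x -> krylov j.+1 (Q *m (A *m x)).
Proof.
move=> jk rk hx y hy; rewrite -hpd_dotvC // -hpd_dotvC //.
apply: hx => i ij; rewrite hpd_dotvC // hpd_dotvC //.
have ri : r i != 0 by apply: residual_neq0 rk; exact: ltnW (ltn_trans ij jk).
have ri1 : r i.+1 != 0 by apply: residual_neq0 rk; exact: ltn_trans ij jk.
have [pr _ _ _] := pcg_invariantP ri.
have [_ ai] := alpha_gt0 ri pr.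
have [_ rS _] := pcg_step_eq ri.
have -> : A *m p i = qreal (alpha i)^-1 *: (r i - r i.+1).
  rewrite rS opprB addrC subrK scalerA -qrealM mulVf ?scale1r //.
  by rewrite gt_eqF.
rewrite mulmx_scaleqr.
suff kr : krylov j.+1 (Q *m (r i - r i.+1)) by rewrite dotvZl kr // mulr0.
rewrite mulmxBr; apply: krylovB.
  by apply: krylovW (krylov_z ri); apply: ltnW.
exact: krylovW (krylov_z ri1).
Qed.

(** One factor [1 - c Q A] of an error polynomial: it has value 1 at 0 and root [1 / c], so [c] is
    meant to be the reciprocal of an eigenvalue. *)
Definition damp (c : R) (e : 'cV[quat R]_n) := e - qreal c *: (Q *m (A *m e)).

(** Each factor has value 1 at 0, so [m] factors move the initial error only within the span of the
    first [m] directions. *)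
Lemma krylov_damp (c : seq R) k : (size c <= k)%N -> r k != 0 ->
  krylov (size c) (foldr damp (u0 - u) c - (u0 - u)).
Proof.
move=> + rk; elim: c => [|c s IH] /= sk.
  by rewrite subrr => y _; rewrite dotvC dotvE mulmx0 mxE.
set e := foldr _ _ _ in IH *; rewrite /damp addrAC.
have he := IH (ltnW sk).
apply: krylovB; first exact: krylovW he.
apply: krylovZ; rewrite -[e](subrK (u0 - u)) mulmxDr mulmxDr.
apply: krylovD; first exact: krylovQA sk rk he.
(* The initial error enters the span because [Q A (u0 - u) = - Q r_0 = - p_0]. *)
have -> : Q *m (A *m (u0 - u)) = qreal (-1) *: p 0.
  rewrite p0E qrealN scaleN1r -mulmxN; congr (_ *m _).
  by rewrite /= mulmxBr Au opprB.
exact/krylovZ/krylov_p.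
Qed.

Lemma krylov_pcg k : r k != 0 -> krylov k (U k - u0).
Proof.
elim: k => [|k IH] rk.
  by rewrite subrr => y _; rewrite dotvC dotvE mulmx0 mxE.
have rk' := residual_neq0 (leqnSn k) rk.
have [-> _ _] := pcg_step_eq rk'; rewrite addrAC.
apply: krylovD; first exact: krylovW (IH rk').
exact/krylovZ/krylov_p.
Qed.

(** The error of [U k] is [A]-orthogonal to the span of the first [k] directions, and every damped
    error differs from it by an element of that span; Pythagoras concludes. *)
Lemma pcg_optimal (c : seq R) (k : nat) : (size c <= k)%N ->
  normA A (pcg_iter A P b u0 k - u) <= normA A (foldr damp (u0 - u) c).
Proof.
move=> ck; rewrite /normA !q0_qform -[pcg_iter _ _ _ _ _]/(U k).
apply: ler_wsqrtr; set e := U k - u; set w := foldr _ _ _.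
have Ae : A *m e = - r k by rewrite pcg_residual mulmxBr Au opprB.
(* A vanished residual makes the left side zero; the orthogonality relations are established for
   nonzero residuals. *)
have [rk|rk] := eqVneq (r k) 0.
  rewrite Ae rk oppr0 [X in X <= _]dotvE mulmx0 mxE; exact: hpd_dotv_ge0.
have hd : krylov k (w - e).
  have -> : w - e = (w - (u0 - u)) - (U k - u0).
    rewrite -addrA -opprD; congr (w - _).
    by rewrite [RHS]addrC addrA subrK.
  by apply: krylovB (krylov_pcg rk); apply: krylovW (krylov_damp ck rk).
have [_ pr _ _] := pcg_invariantP rk.
have h0 : dotv (w - e) (A *m e) = 0 by rewrite Ae dotvNr hd // oppr0.
rewrite -[w](subrK e); exact: hpd_pythagoras.
Qed.

End PCG.

(** * Simultaneous diagonalization of a Hermitian pencil *)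

Local Open Scope sesquilinear_scope.

(** Dimension count: [q] linear equations in more than [q] coordinates allowed to be nonzero. *)
Lemma kernel_supported (F : fieldType) (q n : nat) (W : 'M[F]_(q, n)) (J : {set 'I_n}) :
  (q < #|J|)%N ->
  exists c : 'cV[F]_n, [/\ c != 0, forall i, i \notin J -> c i 0 = 0 & W *m c = 0].
Proof.
move=> qJ; pose E : 'M[F]_(#|J|, n) := \matrix_(k, i) (enum_val k == i)%:R.
have EE : E *m E^T = 1%:M.
  apply/matrixP => k l; rewrite !mxE (bigD1 (enum_val k)) //= !mxE eqxx mul1r.
  rewrite big1 ?addr0; first by rewrite eq_sym (inj_eq enum_val_inj).
  by move=> i ik; rewrite !mxE eq_sym (negbTE ik) mul0r.
have : kermx (E *m W^T) != 0.
  rewrite -mxrank_eq0 mxrank_ker subn_eq0 -ltnNge.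
  exact: leq_ltn_trans (rank_leq_col _) qJ.
case/rowV0Pn => v /sub_kermxP vM v0; exists (v *m E)^T; split.
- apply: contra v0 => /eqP/(congr1 trmx); rewrite trmxK trmx0 => vE.
  by rewrite -[v]mulmx1 -EE mulmxA vE mul0mx.
- move=> i iJ; rewrite !mxE big1 // => k _; rewrite mxE.
  case: eqP => [ki|]; last by rewrite mulr0.
  by rewrite -ki enum_valP in iJ.
- by rewrite -[LHS]trmxK trmx_mul trmxK -mulmxA vM trmx0.
Qed.

Lemma adjmxM (C : numClosedFieldType) (m n l : nat) (A : 'M[C]_(m, n)) (B : 'M[C]_(n, l)) :
  (A *m B)^t* = B^t* *m A^t*.
Proof. by rewrite trmx_mul map_mxM. Qed.

Lemma hermitian_spectral (C : numClosedFieldType) (n : nat) (A : 'M[C]_n) :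
  A^t* = A -> exists (U : 'M[C]_n) (d : 'rV[C]_n),
  [/\ U^t* *m U = 1%:M, U *m U^t* = 1%:M, d \is a realmx & A = U^t* *m diag_mx d *m U].
Proof.
move=> hA; have hA' : A \is hermsymmx.
  by apply/is_hermitianmxP; rewrite expr0 scale1r hA.
have UU := unitarymxP (spectral_unitarymx A).
exists (spectralmx A), (spectral_diag A); split=> //.
- exact: mulmx1C.
- exact: hermitian_spectral_diag_real.
- rewrite -invmx_unitary ?spectral_unitarymx //.
  exact/orthomx_spectralP/hermitian_normalmx.
Qed.

(** [P] is first reduced to the identity by [Y0], the product of the square roots of its eigenvalues
    and its unitary diagonalizer. The congruent matrix [B] of [A] is still Hermitian, and
    diagonalizing it by a unitary [V] preserves the identity. *)
Lemma simultaneous_diag (C : numClosedFieldType) (n : nat) (A P : 'M[C]_n) :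
  A^t* = A -> P^t* = P ->
  (forall x : 'cV[C]_n, x != 0 -> 0 < (x^t* *m P *m x) 0 0) ->
  exists (Y : 'M[C]_n) (d : 'rV[C]_n),
    [/\ Y \in unitmx, d \is a realmx, P = Y^t* *m Y & A = Y^t* *m diag_mx d *m Y].
Proof.
move=> hA hP P_gt0.
have [U [e [UsU UUs _ PE]]] := hermitian_spectral hP.
(* An eigenvalue of [P] is the value of its form at the corresponding unit eigenvector. *)
have e_gt0 i : 0 < e 0 i.
  have x0 : U^t* *m (delta_mx i 0 : 'cV[C]_n) != 0.
    apply/eqP => /(congr1 (mulmx U)); rewrite mulmxA UUs mul1mx mulmx0.
    by move=> /colP/(_ i); rewrite !mxE !eqxx => /eqP; rewrite oner_eq0.
  have := P_gt0 _ x0; rewrite adjmxM trmxCK PE !mulmxA.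
  rewrite -[X in X *m diag_mx e]mulmxA UUs mulmx1.
  rewrite -[X in X *m delta_mx _ _]mulmxA UUs mulmx1.
  by rewrite trmx_delta map_delta_mx -rowE -colE !mxE eqxx mulr1n.
pose s : 'rV[C]_n := \row_i sqrtC (e 0 i).
have sE : diag_mx e = diag_mx s *m diag_mx s.
  rewrite mulmx_diag; congr diag_mx; apply/rowP => i.
  by rewrite !mxE -expr2 sqrtCK.
have hs : (diag_mx s)^t* = diag_mx s.
  rewrite tr_diag_mx map_diag_mx; congr diag_mx; apply/rowP => i.
  by rewrite !mxE; apply/CrealP; rewrite ger0_real // sqrtC_ge0 ltW.
pose Y0 := diag_mx s *m U.
have PY0 : P = Y0^t* *m Y0.
  by rewrite adjmxM hs PE sE !mulmxA.
have Y0u : Y0 \in unitmx.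
  have : Y0 *m (U^t* *m diag_mx (\row_i (sqrtC (e 0 i))^-1)) = 1%:M.
    rewrite !mulmxA -[X in X *m diag_mx _]mulmxA UUs mulmx1 mulmx_diag -diag_const_mx.
    congr diag_mx; apply/rowP => i; rewrite !mxE divff //.
    by rewrite sqrtC_eq0 gt_eqF.
  by case/mulmx1_unit.
clearbody Y0.
pose B := (invmx Y0)^t* *m A *m invmx Y0.
have hB : B^t* = B by rewrite /B !adjmxM trmxCK hA mulmxA.
have [V [d [VsV _ dR BE]]] := hermitian_spectral hB.
have iY : Y0^t* *m (invmx Y0)^t* = 1%:M.
  by rewrite -adjmxM mulVmx // trmx1 map_mx1.
exists (V *m Y0), d; split=> //.
- rewrite unitmx_mul Y0u andbT; by have [] := mulmx1_unit (mulmx1C VsV).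
- by rewrite adjmxM !mulmxA -[X in X *m Y0]mulmxA VsV mulmx1.
- transitivity (Y0^t* *m B *m Y0); last by rewrite BE adjmxM !mulmxA.
  by rewrite /B !mulmxA iY mul1mx -mulmxA mulVmx // mulmx1.
Qed.

(** * Complex representation of quaternion vectors and matrices *)

Definition cq1 (R : realType) (a : quat R) : R[i] := Complex (q0 a) (q1 a).
Definition cq2 (R : realType) (a : quat R) : R[i] := Complex (q2 a) (q3 a).

(* [cvec x] is the first column of the complex 2n x 2 matrix attached to [x],
   so that [cvec] intertwines the action of A with that of its complex
   adjoint matrix [cmat A]. *)
Definition cvec (R : realType) (n : nat) (x : 'cV[quat R]_n) : 'cV[R[i]]_(n + n) :=
  col_mx (\col_i cq1 (x i 0)) (\col_i - Num.conj (cq2 (x i 0))).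

Definition cmat (R : realType) (n : nat) (A : 'M[quat R]_n) : 'M[R[i]]_(n + n) :=
  block_mx (map_mx (@cq1 R) A) (map_mx (@cq2 R) A)
    (map_mx (fun a => - Num.conj (cq2 a)) A) (map_mx (fun a => Num.conj (cq1 a)) A).

(** The squared modulus with values in [R]; the norm of [R[i]] takes its values in [R[i]]. *)
Definition cnorm2 (R : realType) (z : R[i]) : R :=
  complex.Re z ^+ 2 + complex.Im z ^+ 2.

Lemma complexP (R : realType) (a b : R[i]) :
  complex.Re a = complex.Re b -> complex.Im a = complex.Im b -> a = b.
Proof. by case: a => x y; case: b => z t /= -> ->. Qed.

Lemma cq1_sum (R : realType) (I : Type) (s : seq I) (P : pred I) (F : I -> quat R) :
  cq1 (\sum_(i <- s | P i) F i) = \sum_(i <- s | P i) cq1 (F i).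
Proof. exact: (big_morph (@cq1 R)). Qed.

Lemma cq2_sum (R : realType) (I : Type) (s : seq I) (P : pred I) (F : I -> quat R) :
  cq2 (\sum_(i <- s | P i) F i) = \sum_(i <- s | P i) cq2 (F i).
Proof. exact: (big_morph (@cq2 R)). Qed.

Lemma Re_sum (R : realType) (I : Type) (s : seq I) (P : pred I) (F : I -> R[i]) :
  complex.Re (\sum_(i <- s | P i) F i) = \sum_(i <- s | P i) complex.Re (F i).
Proof. by apply: (big_morph (@complex.Re R)) => // -[a b] [c d]. Qed.

Lemma cvec_mulmx (R : realType) (n : nat) (A : 'M[quat R]_n) (x : 'cV[quat R]_n) :
  cvec (A *m x) = cmat A *m cvec x.
Proof.
rewrite /cvec /cmat mul_block_col; congr col_mx; apply/colP => i; rewrite !mxE.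
  rewrite cq1_sum -big_split; apply: eq_bigr => k _; rewrite !mxE.
  by apply: complexP => /=; ring.
rewrite cq2_sum rmorph_sum -sumrN -big_split; apply: eq_bigr => k _; rewrite !mxE.
by apply: complexP => /=; ring.
Qed.

Lemma cvec_surj (R : realType) (n : nat) (X : 'cV[R[i]]_(n + n)) :
  exists x, cvec x = X.
Proof.
exists (\col_i Quat (complex.Re (X (lshift n i) 0)) (complex.Im (X (lshift n i) 0))
  (- complex.Re (X (rshift n i) 0)) (complex.Im (X (rshift n i) 0))).
rewrite -[RHS]vsubmxK; congr col_mx; apply/colP => i; rewrite !mxE.
  by apply: complexP.
by apply: complexP => /=; rewrite opprK.
Qed.

Lemma cvecB (R : realType) (n : nat) (x y : 'cV[quat R]_n) :
  cvec (x - y) = cvec x - cvec y.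
Proof.
rewrite /cvec opp_col_mx add_col_mx; congr col_mx; apply/colP => i; rewrite !mxE.
  by apply: complexP.
by apply: complexP => /=; ring.
Qed.

Lemma cvecZ (R : realType) (n : nat) (a : R) (x : 'cV[quat R]_n) :
  cvec (qreal a *: x) = (Complex a 0) *: cvec x.
Proof.
rewrite /cvec scale_col_mx; congr col_mx; apply/colP => i; rewrite !mxE.
  by apply: complexP => /=; ring.
by apply: complexP => /=; ring.
Qed.

Lemma cvec_eq0 (R : realType) (n : nat) (x : 'cV[quat R]_n) (i : 'I_n) :
  cvec x (lshift n i) 0 = 0 -> cvec x (rshift n i) 0 = 0 -> x i 0 = 0.
Proof.
rewrite /cvec col_mxEu col_mxEd !mxE => -[h0 h1] -[h2 h3].
by apply: quatP => //=; lra.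
Qed.

Lemma Re_dot_cvec (R : realType) (n : nat) (x y : 'cV[quat R]_n) :
  complex.Re (((cvec x)^t* *m cvec y) 0 0) = dotv x y.
Proof.
rewrite /cvec tr_col_mx map_row_mx mul_row_col !mxE -big_split Re_sum.
by apply: eq_bigr => k _; rewrite !mxE /dotq /=; ring.
Qed.

Lemma cmat_adj (R : realType) (n : nat) (A : 'M[quat R]_n) :
  (cmat A)^t* = cmat (adjq A).
Proof.
rewrite /cmat tr_block_mx map_block_mx; congr block_mx; apply/matrixP => i j.
all: rewrite !mxE; apply: complexP => /=; ring.
Qed.

(** Every complex vector is some [cvec x], so positivity carries over from [A]. The order of [R[i]]
    also demands a zero imaginary part, which comes from [A] being Hermitian. *)
Lemma cmat_gt0 (R : realType) (n : nat) (A : 'M[quat R]_n) (X : 'cV[R[i]]_(n + n)) :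
  hpd A -> X != 0 -> 0 < (X^t* *m cmat A *m X) 0 0.
Proof.
move=> hA; have [x <-] := cvec_surj X => x0.
rewrite -mulmxA -cvec_mulmx ltcE Re_dot_cvec; apply/andP; split.
  have [hh _] := hA; set z := _ 0 0; have : Num.conj z = z.
    have adjE (M : 'M[R[i]]_1) : Num.conj (M 0 0) = M^t* 0 0 by rewrite !mxE.
    rewrite /z adjE; congr (fun_of_matrix _ 0 0).
    by rewrite cvec_mulmx !adjmxM trmxCK cmat_adj hh mulmxA.
  by case: z => a b -[] h; apply/eqP => /=; lra.
apply: hpd_dotv_gt0 => //; apply: contra x0 => /eqP ->; apply/eqP.
by have := cvecB (0 : 'cV[quat R]_n) 0; rewrite !subrr.
Qed.

(** The coordinates are [Y] applied to [cvec x], with [Y] diagonalizing both forms; in them [P^-1 A]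
    multiplies by the real numbers [d i]. In the last clause, vanishing on [K] costs two complex
    equations per index, against [#|J|] free coordinates. *)
Lemma pencil_coordinates (R : realType) (n : nat) (A P : 'M[quat R]_n) :
  hpd A -> hpd P ->
  exists (c : 'cV[quat R]_n -> 'cV[R[i]]_(n + n)) (d : 'I_(n + n) -> R),
  [/\ forall x y, c (x - y) = c x - c y,
      forall a x, c (qreal a *: x) = Complex a 0 *: c x,
      forall x, dotv x (P *m x) = \sum_i cnorm2 (c x i 0),
      forall x, dotv x (A *m x) = \sum_i d i * cnorm2 (c x i 0) &
      (forall x y, P *m y = A *m x -> forall i, c y i 0 = Complex (d i) 0 * c x i 0) /\
      forall (K : {set 'I_n}) (J : {set 'I_(n + n)}), (2 * #|K| < #|J|)%N ->
        exists x, [/\ c x != 0, forall k, k \in K -> x k 0 = 0 &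
                      forall i, i \notin J -> c x i 0 = 0]].
Proof.
move=> hA hP.
have cA : (cmat A)^t* = cmat A by rewrite cmat_adj; case: hA => ->.
have cP : (cmat P)^t* = cmat P by rewrite cmat_adj; case: hP => ->.
have [Y [d [Yu dR PE AE]]] := simultaneous_diag cA cP (fun X => cmat_gt0 hP).
pose c x := Y *m cvec x.
have dE i : d 0 i = Complex (complex.Re (d 0 i)) 0.
  by apply/esym/RRe_real; move/mxOverP: dR; apply.
exists c, (fun i => complex.Re (d 0 i)); split.
- by move=> x y; rewrite /c cvecB mulmxBr.
- by move=> a x; rewrite /c cvecZ -scalemxAr.
- move=> x; rewrite -Re_dot_cvec cvec_mulmx PE.
  transitivity (complex.Re (((c x)^t* *m c x) 0 0)).
    by rewrite /c adjmxM !mulmxA.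
  rewrite mxE Re_sum; apply: eq_bigr => i _; rewrite !mxE /cnorm2.
  by case: (\sum_j _) => a b /=; ring.
- move=> x; rewrite -Re_dot_cvec cvec_mulmx AE.
  transitivity (complex.Re (((c x)^t* *m (diag_mx d *m c x)) 0 0)).
    by rewrite /c adjmxM !mulmxA.
  rewrite mxE Re_sum; apply: eq_bigr => i _; rewrite mul_diag_mx !mxE /cnorm2.
  by rewrite dE; case: (\sum_j _) => a b /=; ring.
split.
- move=> x y /(congr1 (@cvec _ _)); rewrite !cvec_mulmx PE AE -!mulmxA => h i.
  have Yu' : Y^t* *m (invmx Y)^t* = 1%:M.
    by rewrite -adjmxM mulVmx // trmx1 map_mx1.
  have : c y = diag_mx d *m c x.
    move/(congr1 (mulmx ((invmx Y)^t*))): h; rewrite !mulmxA.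
    by rewrite (mulmx1C Yu') !mul1mx.
  by move=> ->; rewrite mul_diag_mx mxE -dE.
move=> K J KJ.
(* Enumerates the two complex coordinates of each quaternion entry indexed by [K]. *)
pose f (k : 'I_(#|K| + #|K|)) := match fintype.split k with
  | inl k' => lshift n (enum_val k') | inr k' => rshift n (enum_val k') end.
have [|v [v0 vJ vW]] := @kernel_supported _ _ _ (rowsub f (invmx Y)) J.
  by rewrite addnn -mul2n.
have [x xE] := cvec_surj (invmx Y *m v).
have cx : c x = v by rewrite /c xE mulmxA mulmxV // mul1mx.
exists x; split=> //; rewrite ?cx //.
move=> k kK; move: vW; rewrite mul_rowsub_mx -xE => /colP vW.
have [j jk] : exists j : 'I_#|K|, enum_val j = k.
  by exists (enum_rank_in kK k); rewrite enum_rankK_in.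
apply: cvec_eq0.
  have := vW (lshift #|K| j); rewrite !mxE /f.
  have -> : fintype.split (lshift #|K| j) = inl j by exact: (unsplitK (inl j)).
  by rewrite jk.
have := vW (rshift #|K| j); rewrite !mxE /f.
have -> : fintype.split (rshift #|K| j) = inr j by exact: (unsplitK (inr j)).
by rewrite jk.
Qed.

(** Rules out the default value of [invmxq]. Systems are solved through the complex matrix, which
    gives a right inverse column by column; positivity makes [P] injective, so this is a left
    inverse too. *)
Lemma hpd_invmxq (R : realType) (n : nat) (P : 'M[quat R]_n) :
  hpd P -> P *m invmxq P = 1%:M.
Proof.
move=> hP; have cP : (cmat P)^t* = cmat P by rewrite cmat_adj; case: hP => ->.
have [Y [_ [Yu _ PE _]]] := simultaneous_diag cP cP (fun X => cmat_gt0 hP).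
have Pu : cmat P \in unitmx by rewrite PE unitmx_mul map_unitmx unitmx_tr Yu.
have inj0 (x : 'cV[quat R]_n) : P *m x = 0 -> x = 0.
  move=> Px; apply/eqP; apply: contraT => x0.
  by have := hpd_dotv_gt0 hP x0; rewrite Px dotvE mulmx0 mxE ltxx.
have surj (y : 'cV[quat R]_n) : exists x, P *m x = y.
  have [x xE] := cvec_surj (invmx (cmat P) *m cvec y).
  exists x; apply/eqP; rewrite -subr_eq0; apply/eqP/colP => i; rewrite [RHS]mxE.
  by apply: cvec_eq0; rewrite cvecB cvec_mulmx xE mulmxA mulmxV // mul1mx subrr mxE.
have [f fE] := choice surj.
pose B : 'M[quat R]_n := \matrix_(i, j) f (delta_mx j 0) i 0.
have PB : P *m B = 1%:M.
  apply/matrixP => i j; have /colP/(_ i) := fE (delta_mx j 0).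
  rewrite !mxE eqxx andbT => <-; apply: eq_bigr => k _; by rewrite !mxE.
have BP : B *m P = 1%:M.
  apply/subr0_eq/matrixP => i j.
  have /colP/(_ i) : (B *m P - 1%:M) *m delta_mx j 0 = 0 :> 'cV_n.
    by apply: inj0; rewrite mulmxA mulmxBr mulmxA PB mul1mx mulmx1 subrr mul0mx.
  by rewrite -colE [LHS]mxE => ->; rewrite !mxE.
rewrite /invmxq; case: xgetP => [Q _ [] //|/(_ B)/=].
by case.
Qed.

(** * Error bound for a clustered spectrum *)

Lemma normr_prod_le (R : realType) (s : seq R) (K : R) :
  (forall a, a \in s -> `|a| <= K) -> `|\prod_(a <- s) a| <= K ^+ size s.
Proof.
elim: s => [|a s IH] h; first by rewrite big_nil normr1.
rewrite big_cons normrM exprS ler_pM // ?h ?mem_head //.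
by apply: IH => b bs; apply: h; rewrite inE bs orbT.
Qed.

(** A nonzero vector vanishing on [K] cannot be a combination of eigenvectors all above [1 + eta],
    or all below [1 - eta]; hence at most [2 * #|K|] eigenvalues lie on each side. The error
    polynomial kills them and contracts the others by [eta]. *)
Lemma pcg_cluster (R : realType) (n : nat) (A P : 'M[quat R]_n) (lo hi eta : R)
    (K : {set 'I_n}) :
  hpd A -> hpd P -> 0 < lo -> 0 <= hi -> 0 <= eta ->
  (forall x, lo * dotv x (P *m x) <= dotv x (A *m x) <= hi * dotv x (P *m x)) ->
  (forall x : 'cV[quat R]_n, (forall k, k \in K -> x k 0 = 0) ->
     `|dotv x (A *m x) - dotv x (P *m x)| <= eta * dotv x (P *m x)) ->
  forall b u0 u : 'cV[quat R]_n, A *m u = b ->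
  forall k : nat, (4 * #|K| <= k)%N ->
  normA A (pcg_iter A P b u0 k - u) <=
  (1 + hi / lo) ^+ (4 * #|K|) * eta ^+ (k - 4 * #|K|) * normA A (u0 - u).
Proof.
move=> hA hP lo0 hi0 eta0 AP APK b u0 u Au k kK.
have [c [d [cB cZ cP cA [cG supp]]]] := pencil_coordinates hA hP.
have cn0 z : 0 <= @cnorm2 R z by rewrite addr_ge0 ?sqr_ge0.
have cn_gt0 (v : 'cV[R[i]]_(n + n)) : v != 0 -> 0 < \sum_i cnorm2 (v i 0).
  move=> v0; rewrite lt_neqAle sumr_ge0 // andbT eq_sym.
  apply: contra v0 => /eqP h; apply/eqP/colP => i; rewrite mxE.
  have := psumr_eq0P (fun j _ => cn0 (v j 0)) h (i := i) isT.
  case: (v i 0) => x y; rewrite /cnorm2 /= => hxy.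
  have [hx hy] : x ^+ 2 = 0 /\ y ^+ 2 = 0.
    by have := sqr_ge0 x; have := sqr_ge0 y; split; lra.
  by apply: complexP; apply/eqP; rewrite /= -sqrf_eq0; apply/eqP.
(* A vector whose only nonzero coordinate is the [i]-th isolates [d i] as the quotient of the two
   forms. *)
have dP i : lo <= d i <= hi.
  have [|x [x0 _ xJ]] := supp finset.set0 [set i]%SET; first by rewrite cards0 cards1.
  have single (f : _ -> R) :
      \sum_j f j * cnorm2 (c x j 0) = f i * cnorm2 (c x i 0).
    rewrite (bigD1 i) //= big1 ?addr0 // => j ji.
    by rewrite xJ ?inE // /cnorm2 /= expr0n /= addr0 mulr0.
  have S1 : \sum_j cnorm2 (c x j 0) = cnorm2 (c x i 0).
    rewrite -[RHS]mul1r -(single (fun=> 1)).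
    by apply: eq_bigr => j _; rewrite mul1r.
  have := AP x; have := cn_gt0 _ x0; rewrite cP cA S1 single => h.
  by rewrite !ler_pM2r.
pose Jp := [set i : 'I_(n + n) | 1 + eta < d i]%SET.
pose Jm := [set i : 'I_(n + n) | d i < 1 - eta]%SET.
(* The sign [sg] is 1 above the cluster and -1 below it, so that one count serves both sides. *)
have cardJ (sg : R) (J : {set 'I_(n + n)}) : `|sg| <= 1 ->
    (forall i, i \in J -> eta < sg * (d i - 1)) -> (#|J| <= 2 * #|K|)%N.
  move=> sg1 hJ; rewrite leqNgt; apply/negP => /supp [x [x0 xK xJ]].
  have := APK x xK; rewrite cP cA -sumrB => h.
  (* These nonnegative terms have a nonpositive sum, so all vanish; then every coordinate of [x]
     vanishes, a contradiction. *)
  pose t i := (sg * (d i - 1) - eta) * cnorm2 (c x i 0).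
  have t0 i : 0 <= t i.
    rewrite /t; have [iJ|iJ] := boolP (i \in J).
      by rewrite mulr_ge0 // subr_ge0 ltW // hJ.
    by rewrite (xJ _ iJ) /cnorm2 /= expr0n /= addr0 mulr0.
  have tS : \sum_i t i = 0.
    apply/eqP; rewrite eq_le sumr_ge0 // andbT.
    have -> : \sum_i t i = sg * \sum_i (d i * cnorm2 (c x i 0) - cnorm2 (c x i 0)) -
                           eta * \sum_i cnorm2 (c x i 0).
      by rewrite !mulr_sumr -sumrB; apply: eq_bigr => i _; rewrite /t; ring.
    rewrite subr_le0; apply: le_trans h; apply: le_trans (ler_norm _) _.
    by rewrite normrM ler_piMl.
  have := cn_gt0 _ x0; rewrite big1 ?ltxx // => i _.
  have [iJ|iJ] := boolP (i \in J); last first.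
    by rewrite (xJ _ iJ) /cnorm2 /= expr0n /= addr0.
  have /eqP := psumr_eq0P (fun i _ => t0 i) tS (i := i) isT.
  by rewrite mulf_eq0 subr_eq0 gt_eqF ?hJ // => /eqP.
have cardJp : (#|Jp| <= 2 * #|K|)%N.
  by apply: (cardJ 1) => [|i]; rewrite ?normr1 // inE mul1r; lra.
have cardJm : (#|Jm| <= 2 * #|K|)%N.
  by apply: (cardJ (-1)) => [|i]; rewrite ?normrN1 // inE mulN1r; lra.
pose out := enum (Jp :|: Jm).
have size_out : (size out <= 4 * #|K|)%N.
  rewrite -cardE (leq_trans (leq_card_setU _ _)) //.
  by rewrite (leq_trans (leq_add cardJp cardJm)) // -mulnDl.
(* [damp] takes reciprocals of roots: the entries 1 give the power of [1 - d], the others a root at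
   each outlier. *)
pose s := nseq (k - 4 * #|K|) 1 ++ [seq (d i)^-1 | i <- out].
have size_s : (size s <= k)%N.
  by rewrite size_cat size_nseq size_map -leq_subRL ?leq_subr // subKn.
have PQ := hpd_invmxq hP.
apply: le_trans (pcg_optimal u0 hA hP erefl PQ Au size_s) _.
set Q := invmxq P in PQ *.
have PG (e : 'cV[quat R]_n) : P *m (Q *m (A *m e)) = A *m e by rewrite mulmxA PQ mul1mx.
have cs e i (l : seq R) : c (foldr (damp A Q) e l) i 0 =
    Complex (\prod_(a <- l) (1 - a * d i)) 0 * c e i 0.
  elim: l => [|a l IH] /=.
    by rewrite big_nil; case: (c e i 0) => x y; apply: complexP => /=; ring.
  rewrite /damp cB cZ !mxE (cG _ _ (PG _)) IH big_cons.
  by case: (c e i 0) => x y; apply: complexP => /=; ring.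
have hl0 : 0 <= 1 + hi / lo.
  by rewrite addr_ge0 // divr_ge0 // ltW.
rewrite /normA !q0_qform !cA.
rewrite -[X in _ <= X * _]ger0_norm ?mulr_ge0 ?exprn_ge0 // -sqrtr_sqr -sqrtrM ?sqr_ge0 //.
apply: ler_wsqrtr; rewrite mulr_sumr; apply: ler_sum => i _.
rewrite cs mulrCA ler_wpM2l //.
  by have /andP[h1 _] := dP i; rewrite (le_trans (ltW lo0)).
set pr := \prod_(a <- s) _.
have -> : cnorm2 (Complex pr 0 * c (u0 - u) i 0) = pr ^+ 2 * cnorm2 (c (u0 - u) i 0).
  by rewrite /cnorm2; case: (c _ i 0) => x y /=; ring.
rewrite ler_wpM2r // -(ger0_norm (sqr_ge0 pr)) normrX lerXn2r ?nnegrE ?mulr_ge0 ?exprn_ge0 //.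
rewrite /pr big_cat normrM mulrC.
(* At an outlier, its own factor makes the product zero. *)
have [iout|iout] := boolP (i \in out).
  rewrite (_ : \prod_(j <- [seq (d i)^-1 | i <- out]) _ = 0).
    by rewrite normr0 mul0r mulr_ge0 ?exprn_ge0.
  rewrite big_map (big_rem i) //= mulVf ?subrr ?mul0r //.
  by rewrite gt_eqF // (lt_le_trans lo0) //; have /andP[] := dP i.
apply: ler_pM => //.
  (* Each outlier factor is at most [1 + d i / d j], hence at most [1 + hi / lo]. *)
  apply: le_trans (_ : (1 + hi / lo) ^+ size out <= _); last first.
    by rewrite ler_weXn2l // lerDl divr_ge0 // ltW.
  rewrite -(size_map (fun j => 1 - (d j)^-1 * d i)) big_map -(big_map _ predT id).
  apply: normr_prod_le => _ /mapP[j _ ->].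
  have /andP[lj _] := dP j; have /andP[li hi_i] := dP i.
  have dj0 : 0 < d j := lt_le_trans lo0 lj.
  apply: le_trans (ler_normB _ _) _; rewrite normr1 lerD2l ger0_norm; last first.
    by rewrite mulr_ge0 ?invr_ge0 ?ltW // (lt_le_trans lo0).
  rewrite mulrC ler_pM ?invr_ge0 ?(ltW dj0) //; first by rewrite ltW // (lt_le_trans lo0).
  by rewrite lef_pV2 ?posrE.
rewrite big_nseq iter_mulr_1 mul1r normrX lerXn2r ?nnegrE //.
move: iout; rewrite mem_enum inE negb_or !inE -!leNgt => /andP[h1 h2].
by rewrite ler_norml; apply/andP; split; lra.
Qed.

(** * Quadratic forms of circulant matrices *)

Section AxisComponents.
Variables (R : realType) (p : quat R).
Hypotheses (p0 : q0 p = 0) (pp : p * p = -1).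

(** As [p * p = -1], the map sending [a] to [- (p * a * p)] is an involution; [axis_comm] and
    [axis_anti] project on its eigenspaces, the quaternions commuting and anticommuting with [p]. *)
Definition axis_comm (a : quat R) : quat R := qreal 2^-1 * (a - p * a * p).
Definition axis_anti (a : quat R) : quat R := qreal 2^-1 * (a + p * a * p).

Lemma axis_split a : axis_comm a + axis_anti a = a.
Proof.
by rewrite -mulrDr addrACA addNr addr0; apply: quatP => /=; lra.
Qed.

Lemma axis_commP a : axis_comm a * p = p * axis_comm a.
Proof.
have h : (a - p * a * p) * p = p * (a - p * a * p).
  rewrite mulrBl mulrBr -(mulrA (p * a) p p) pp mulrN1 opprK !mulrA pp mulN1r.
  by rewrite mulNr opprK addrC.
by rewrite /axis_comm -mulrA h !mulrA (qrealC _ p).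
Qed.

Lemma axis_antiP a : axis_anti a * p = - (p * axis_anti a).
Proof.
have h : (a + p * a * p) * p = - (p * (a + p * a * p)).
  rewrite mulrDl mulrDr -(mulrA (p * a) p p) pp mulrN1 !mulrA pp mulN1r.
  by rewrite mulNr opprB.
by rewrite /axis_anti -mulrA h mulrN; congr (- _); rewrite !mulrA (qrealC _ p).
Qed.

Lemma axis_commD a b : axis_comm (a + b) = axis_comm a + axis_comm b.
Proof. by rewrite /axis_comm (mulrDr p) mulrDl opprD addrACA mulrDr. Qed.

Lemma axis_antiD a b : axis_anti (a + b) = axis_anti a + axis_anti b.
Proof. by rewrite /axis_anti (mulrDr p) mulrDl addrACA mulrDr. Qed.

Lemma axis_comm_sum (I : Type) (s : seq I) (P : pred I) (F : I -> quat R) :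
  axis_comm (\sum_(i <- s | P i) F i) = \sum_(i <- s | P i) axis_comm (F i).
Proof.
apply: (big_morph axis_comm axis_commD).
by rewrite /axis_comm mulr0 mul0r subr0 mulr0.
Qed.

Lemma axis_anti_sum (I : Type) (s : seq I) (P : pred I) (F : I -> quat R) :
  axis_anti (\sum_(i <- s | P i) F i) = \sum_(i <- s | P i) axis_anti (F i).
Proof.
apply: (big_morph axis_anti axis_antiD).
by rewrite /axis_anti mulr0 mul0r addr0 mulr0.
Qed.

Lemma axis_commM a b : b * p = p * b -> axis_comm (a * b) = axis_comm a * b.
Proof.
move=> bp; rewrite /axis_comm -[RHS]mulrA; congr (_ * _).
by rewrite mulrBl -!mulrA bp.
Qed.

Lemma axis_antiM a b : b * p = p * b -> axis_anti (a * b) = axis_anti a * b.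
Proof.
move=> bp; rewrite /axis_anti -[RHS]mulrA; congr (_ * _).
by rewrite mulrDl -!mulrA bp.
Qed.

Lemma conj_axis_comm a : conjq (axis_comm a) = axis_comm (conjq a).
Proof.
have h : conjq (qreal 2^-1) = qreal 2^-1 :> quat R by apply: quatP; rewrite /= ?oppr0.
rewrite /axis_comm conjqM h -qrealC conjqD; congr (_ * (_ + _)).
have -> : conjq (- (p * a * p)) = - conjq (p * a * p).
  by apply: quatP.
by rewrite !conjqM (conjq_pure p0) mulrN mulNr mulrN opprK mulrA.
Qed.

(** The anticommuting part has zero real part, because [q0 (x * y) = q0 (y * x)]. *)
Lemma q0_axis_comm a : q0 (axis_comm a) = q0 a.
Proof.
have -> : q0 a = q0 (axis_comm a) + q0 (axis_anti a) by rewrite -q0D axis_split.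
suff -> : q0 (axis_anti a) = 0 by rewrite addr0.
have h : axis_anti a = p * axis_anti a * p.
  by rewrite -mulrA axis_antiP mulrN mulrA pp mulN1r opprK.
have q0C (x y : quat R) : q0 (x * y) = q0 (y * x) by rewrite /=; ring.
have : q0 (axis_anti a) = - q0 (axis_anti a).
  by rewrite {1}h q0C mulrA pp mulN1r.
by move=> ?; lra.
Qed.

Let pp1 : q1 p ^+ 2 + q2 p ^+ 2 + q3 p ^+ 2 = 1.
Proof. by have := congr1 (@q0 R) pp; rewrite /= p0; lra. Qed.

Lemma qexpD x y : qexp p (x + y) = qexp p x * qexp p y.
Proof.
rewrite /qexp cosD sinD; apply: quatP => /=; rewrite p0; try ring.
by have := congr1 ( *%R (sin x * sin y)) pp1; lra.
Qed.

Lemma qexp0 : qexp p 0 = 1.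
Proof. by rewrite /qexp cos0 sin0; apply: quatP => /=; rewrite ?p0; ring. Qed.

Lemma conj_qexp y : conjq (qexp p y) = qexp p (- y).
Proof. by rewrite /qexp cosN sinN; apply: quatP => /=; rewrite ?p0; ring. Qed.

Lemma qexp_axis y : qexp p y * p = p * qexp p y.
Proof. by rewrite /qexp mulrDl mulrDr qrealC -!mulrA qrealC. Qed.

Lemma qexpNr y : qexp p (- y) * qexp p y = 1.
Proof. by rewrite -qexpD addNr qexp0. Qed.

Lemma normq_qexp y : normq (qexp p y) = 1.
Proof.
apply/eqP; rewrite -sqrp_eq1 ?normq_ge0 // expr2 -{1}normq_conj -normqM conj_qexp.
by rewrite qexpNr -[1]/(qreal 1) normq_real normr1.
Qed.

Lemma qexpMn y m : qexp p (m%:R * y) = qexp p y ^+ m.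
Proof.
elim: m => [|m IH]; first by rewrite mul0r qexp0.
by rewrite -natr1 mulrDl mul1r qexpD IH exprSr.
Qed.

Lemma qexp_exp_comm a y m : a * p = p * a -> qexp p y ^+ m * a = a * qexp p y ^+ m.
Proof.
move=> ap; apply/esym/commrX; rewrite /GRing.comm /qexp mulrDr mulrDl.
by rewrite qrealC; congr (_ + _); rewrite mulrA ap -!mulrA qrealC.
Qed.

(** Moving across a quaternion that anticommutes with [p] reverses the frequency; this is what
    couples [th] with [- th]. *)
Lemma qexp_exp_anti a y m :
  a * p = - (p * a) -> qexp p y ^+ m * a = a * qexp p (- y) ^+ m.
Proof.
move=> ap; elim: m => [|m IH]; first by rewrite mul1r mulr1.
rewrite exprSr -mulrA.
have -> : qexp p y * a = a * qexp p (- y).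
  rewrite /qexp cosN sinN mulrDl mulrDr qrealC; congr (_ + _).
  by rewrite mulrA ap qrealN mulrN mulNr opprK -!mulrA qrealC.
by rewrite mulrA IH -mulrA -exprSr.
Qed.

Lemma qexp_2pi : qexp p (pi *+ 2) = 1.
Proof. by rewrite /qexp cos2pi sin2pi; apply: quatP => /=; ring. Qed.

(** By the double angle formula, cosine 1 would force [sin (|y| / 2) = 0] with [|y| / 2] strictly
    between 0 and [pi]. *)
Lemma qexp_neq1 y : 0 < `|y| < pi *+ 2 -> qexp p y != 1.
Proof.
move=> /andP[y0 y2]; apply/eqP => /(congr1 (@q0 R)) /=.
rewrite p0 mul0r !mulr0 !subr0 addr0 => cy.
have : cos (`|y| / 2 *+ 2) = 1.
  by rewrite -mulr_natr divfK ?pnatr_eq0 //; case: (ger0P y) => _; rewrite ?cosN.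
rewrite cos_mulr2n => h.
have s0 : sin (`|y| / 2) ^+ 2 = 0 by rewrite sin2cos2; lra.
have : 0 < sin (`|y| / 2) by apply: sin_gt0_pi; rewrite divr_gt0 // ltr_pdivrMr //; lra.
by move/eqP: s0; rewrite sqrf_eq0 => /eqP ->; rewrite ltxx.
Qed.

(** The sum times [w - 1] is [w ^+ n - 1 = 0], and multiplicativity of [normq] excludes zero
    divisors. *)
Lemma qexp_geometric_sum y n : qexp p y ^+ n = 1 -> qexp p y != 1 ->
  \sum_(k < n) qexp p y ^+ k = 0.
Proof.
move=> wn w1; have := subrX1 (qexp p y) n; rewrite wn subrr => /esym/(congr1 (@normq R)).
rewrite normqM normq0 => /eqP; rewrite mulf_eq0 => /orP[]/eqP h.
  case/negP: w1; rewrite -subr_eq0 -dotq_eq0 -sqr_normq h expr0n //.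
by apply/eqP; rewrite -dotq_eq0 -sqr_normq h expr0n.
Qed.

End AxisComponents.

Section CirculantForm.
Variables (R : realType) (p : quat R).
Hypotheses (p0 : q0 p = 0) (pp : p * p = -1).

Definition qdft n (x : 'cV[quat R]_n) (th : R) : quat R :=
  \sum_(l < n) qexp p th ^+ l * x l 0.

Lemma qexp_root n (th : R) : n%:R * `|th| = pi *+ 2 -> qexp p th ^+ n = 1.
Proof.
move=> h; rewrite -qexpMn //; case: (ger0P th) h => _ h; first by rewrite h qexp_2pi.
by rewrite -[n%:R * th]opprK -mulrN h -conj_qexp // qexp_2pi //; apply: quatP; rewrite /= ?oppr0.
Qed.

(** Orthogonality of characters through geometric sums. Only the absolute value of [th] is
    prescribed, so that both signs of the basic frequency are covered. *)
Lemma qdft_parseval n (x z : 'cV[quat R]_n) (th : R) : n%:R * `|th| = pi *+ 2 ->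
  \sum_(k < n) dotq (qdft x (k%:R * th)) (qdft z (k%:R * th)) = n%:R * dotv x z.
Proof.
move=> hth.
pose g (l m : 'I_n) := qexp p (m%:R * th - l%:R * th).
have root_mn (m : 'I_n) : qexp p (n%:R * (m%:R * th)) = 1.
  by rewrite mulrCA !qexpMn // qexp_root // expr1n.
have gn l m : g l m ^+ n = 1.
  rewrite -qexpMn // mulrBr qexpD // root_mn -conj_qexp // root_mn mul1r.
  by apply: quatP; rewrite /= ?oppr0.
have gsum l m : \sum_(k < n) g l m ^+ k = if l == m then qreal n%:R else 0.
  case: eqP => [->|/eqP lm].
    under eq_bigr => k _ do rewrite /g subrr qexp0 // expr1n.
    rewrite sumr_const card_ord; elim: (n) => [|k IH]; first by rewrite mulr0n.
    by rewrite mulrS IH -natr1 qrealD addrC.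
  rewrite /g in gn *; apply: qexp_geometric_sum; rewrite ?gn //.
  apply: qexp_neq1 => //.
  have n0 : (0 : R) < n%:R by rewrite ltr0n (leq_ltn_trans (leq0n l)).
  have th0 : 0 < `|th|.
    rewrite lt_neqAle normr_ge0 andbT; apply/eqP => th0.
    by move: hth (pi_gt0 R); rewrite -th0 mulr0; lra.
  rewrite -mulrBl normrM -hth pmulr_lgt0 // ltr_pM2r // normr_gt0 subr_eq0 eqr_nat.
  rewrite eq_sym lm /= ltr_norml.
  have hm : (m%:R : R) < n%:R by rewrite ltr_nat.
  have hl : (l%:R : R) < n%:R by rewrite ltr_nat.
  by have := ler0n R m; have := ler0n R l; lra.
have term (k : nat) (l m : 'I_n) :
    dotq (qexp p (k%:R * th) ^+ l * x l 0) (qexp p (k%:R * th) ^+ m * z m 0) =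
    q0 (conjq (x l 0) * g l m ^+ k * z m 0).
  rewrite dotqE conjqM -!qexpMn // conj_qexp // !mulrA -(mulrA (conjq _)) -qexpD //.
  by congr (q0 (_ * qexp _ _ * _)); ring.
pose F l m (k : nat) := q0 (conjq (x l 0) * g l m ^+ k * z m 0).
have dq (k : nat) : dotq (qdft x (k%:R * th)) (qdft z (k%:R * th)) =
    \sum_l \sum_m F l m k.
  rewrite dotqE conjq_sum mulr_suml q0_sum; apply: eq_bigr => l _.
  by rewrite mulr_sumr q0_sum; apply: eq_bigr => m _; rewrite -dotqE term.
have Fsum l m : \sum_(k < n) F l m k = if l == m then n%:R * dotq (x l 0) (z l 0) else 0.
  rewrite -q0_sum -mulr_suml -mulr_sumr gsum; case: eqP => [<-|_].
    by rewrite -(qrealC _ (conjq _)) -mulrA dotqE /=; ring.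
  by rewrite mulr0 mul0r.
clearbody F; under eq_bigr => k _ do rewrite dq.
rewrite exchange_big /dotv mulr_sumr; apply: eq_bigr => l _.
rewrite exchange_big /= (eq_bigr _ (fun m _ => Fsum l m)) -big_mkcond /=.
by rewrite (big_pred1 l) // => m; rewrite /= eq_sym.
Qed.

(** The coefficients stand on the left of the exponentials, as in the generating function. *)
Definition circ_symbol n (v : 'cV[quat R]_n) (th : R) : quat R :=
  \sum_(d < n) v d 0 * qexp p th ^+ d.

(** The product is a cyclic convolution. The exponentials pass unchanged across the commuting parts
    of the coefficients, and with reversed frequency across the anticommuting parts. *)
Lemma qdft_circulant n (v x : 'cV[quat R]_n) (th : R) : qexp p th ^+ n = 1 ->
  qdft (circulant v *m x) th =
    axis_comm p (circ_symbol v th) * qdft x th +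
    axis_anti p (circ_symbol v (- th)) * qdft x (- th).
Proof.
move=> wn.
have wnN : qexp p (- th) ^+ n = 1.
  have h : qexp p (n%:R * th) = 1 by rewrite qexpMn.
  by rewrite -qexpMn // mulrN -conj_qexp // h; apply: quatP; rewrite /= ?oppr0.
pose w := qexp p th; pose w' := qexp p (- th).
have wc m : w ^+ m * p = p * w ^+ m by apply/esym/commrX; rewrite /GRing.comm qexp_axis.
have wc' m : w' ^+ m * p = p * w' ^+ m.
  by apply/esym/commrX; rewrite /GRing.comm qexp_axis.
transitivity (\sum_(l < n) \sum_(d < n) (w ^+ (d + l) * v d 0 * x l 0)).
  transitivity (\sum_(j < n) \sum_(l < n) w ^+ j * (v (circ_index j l) 0 * x l 0)).
    apply: eq_bigr => j _; rewrite mxE mulr_sumr; apply: eq_bigr => l _.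
    by rewrite !mxE.
  rewrite exchange_big; apply: eq_bigr => l _ /=.
  have n0 : (0 < n)%N := leq_ltn_trans (leq0n l) (ltn_ord l).
  (* For a fixed column [l], rows are reindexed by the offset [d = j - l] modulo [n]; the hypothesis
     [wn] allows the reduction of exponents. *)
  pose h (d : 'I_n) := Ordinal (ltn_pmod (d + l) n0).
  have ch d : circ_index (h d) l = d.
    apply: val_inj; rewrite /= modnDml -addnA subnKC; last exact: ltnW.
    by rewrite modnDr modn_small.
  have hb : bijective h.
    by apply: injF_bij => d e /(congr1 (fun j => circ_index j l)); rewrite !ch.
  rewrite (reindex h) /=; last exact: onW_bij.
  by apply: eq_bigr => d _; rewrite ch mulrA expr_mod.
have split_term (l d : 'I_n) : w ^+ (d + l) * v d 0 * x l 0 =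
    axis_comm p (v d 0) * w ^+ d * (w ^+ l * x l 0) +
    axis_anti p (v d 0) * w' ^+ d * (w' ^+ l * x l 0).
  rewrite -{1}(axis_split p (v d 0)) mulrDr mulrDl.
  rewrite qexp_exp_comm; last exact: axis_commP.
  rewrite qexp_exp_anti; last exact: axis_antiP.
  by rewrite !exprD !mulrA.
under eq_bigr => l _ do under eq_bigr => d _ do rewrite split_term.
under eq_bigr => l _ do rewrite big_split /= -!mulr_suml.
rewrite big_split /= -!mulr_sumr; congr (_ * _ + _ * _).
  by rewrite axis_comm_sum; apply: eq_bigr => d _; rewrite axis_commM.
by rewrite axis_anti_sum; apply: eq_bigr => d _; rewrite axis_antiM.
Qed.

Lemma dotqDr (a b c : quat R) : dotq a (b + c) = dotq a b + dotq a c.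
Proof. by rewrite /dotq /=; ring. Qed.

(** Parseval turns the form into a sum over frequencies; running it for [th] and for [- th] doubles
    the sum and pairs opposite frequencies. Cauchy-Schwarz on the coupling terms leaves the 2 x 2
    forms of the last hypothesis. *)
Lemma circulant_coercive n (v x : 'cV[quat R]_n) (delta : R) : (0 < n)%N ->
  (forall th, qexp p th ^+ n = 1 ->
     axis_comm p (circ_symbol v th) = qreal (q0 (circ_symbol v th))) ->
  (forall th a b, qexp p th ^+ n = 1 -> 0 <= a -> 0 <= b ->
     delta * (a ^+ 2 + b ^+ 2) <=
     q0 (circ_symbol v th) * a ^+ 2 + q0 (circ_symbol v (- th)) * b ^+ 2
     - (normq (axis_anti p (circ_symbol v th)) +
        normq (axis_anti p (circ_symbol v (- th)))) * (a * b)) ->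
  delta * dotv x x <= dotv x (circulant v *m x).
Proof.
move=> n0 Vr hV; pose th : R := pi *+ 2 / n%:R.
have nR : (0 : R) < n%:R by rewrite ltr0n.
have pi2 : (0 : R) < pi *+ 2 by have := pi_gt0 R; lra.
have hth : n%:R * `|th| = pi *+ 2.
  by rewrite ger0_norm ?divr_ge0 ?ltW // mulrC divfK // gt_eqF.
have hthN : n%:R * `|- th| = pi *+ 2 by rewrite normrN.
have root k : qexp p (k%:R * th) ^+ n = 1.
  by rewrite -qexpMn // mulrCA !qexpMn // qexp_root // expr1n.
have rootN k : qexp p (- (k%:R * th)) ^+ n = 1.
  by rewrite -mulrN -qexpMn // mulrCA !qexpMn // qexp_root // expr1n.
pose X k := qdft x (k%:R * th); pose X' k := qdft x (- (k%:R * th)).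
pose y := circulant v *m x.
have form1 k : q0 (circ_symbol v (k%:R * th)) * normq (X k) ^+ 2 -
    normq (axis_anti p (circ_symbol v (- (k%:R * th)))) * (normq (X k) * normq (X' k))
    <= dotq (X k) (qdft y (k%:R * th)).
  rewrite qdft_circulant // dotqDr Vr // lerD //.
    by rewrite sqr_normq /dotq /=; apply: eq_ler; ring.
  rewrite lerNl; apply: le_trans (ler_norm _) _; rewrite normrN.
  apply: le_trans (normr_dotq _ _) _; rewrite normqM.
  by apply: eq_ler; rewrite /X /X'; ring.
have form2 k : q0 (circ_symbol v (- (k%:R * th))) * normq (X' k) ^+ 2 -
    normq (axis_anti p (circ_symbol v (k%:R * th))) * (normq (X k) * normq (X' k))
    <= dotq (X' k) (qdft y (- (k%:R * th))).
  rewrite qdft_circulant // opprK dotqDr Vr // lerD //.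
    by rewrite sqr_normq /dotq /=; apply: eq_ler; ring.
  rewrite lerNl; apply: le_trans (ler_norm _) _; rewrite normrN.
  apply: le_trans (normr_dotq _ _) _; rewrite normqM.
  by apply: eq_ler; rewrite /X /X'; ring.
have sum1 (z : 'cV[quat R]_n) :
    \sum_(k < n) dotq (X k) (qdft z (k%:R * th)) = n%:R * dotv x z.
  exact: qdft_parseval.
have sum2 (z : 'cV[quat R]_n) :
    \sum_(k < n) dotq (X' k) (qdft z (- (k%:R * th))) = n%:R * dotv x z.
  rewrite -(qdft_parseval x z hthN); apply: eq_bigr => k _.
  by rewrite /X' mulrN.
suff : n%:R * (delta * dotv x x) *+ 2 <= n%:R * dotv x y *+ 2.
  by rewrite lerMn2r /= ler_pM2l.
rewrite [leRHS]mulr2n -{1}sum1 -sum2 -big_split mulrCA mulr2n -mulrDr.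
rewrite -{1}sum1 -sum2 -big_split mulr_sumr; apply: ler_sum => k _ /=.
apply: le_trans (lerD (form1 k) (form2 k)).
have := hV _ _ _ (root k) (normq_ge0 (X k)) (normq_ge0 (X' k)).
rewrite -!sqr_normq; move: (normq (X k)) (normq (X' k)) => a c.
move: (q0 _) (q0 _) (normq _) (normq _) => A B C D; clear; lra.
Qed.

End CirculantForm.

(** * Generating function and Strang matrix *)

Definition gen_partial (R : realType) (p : quat R) (t : nat -> quat R) (m : nat) (th : R)
    : quat R :=
  t 0%N + \sum_(s < m) (t s.+1 * qexp p (s.+1%:R * th)
                        + conjq (t s.+1) * qexp p (- (s.+1%:R * th))).

Lemma ext_seqN (R : realType) (t : nat -> quat R) (s : nat) :
  (0 < s)%N -> ext_seq t (- s%:Z) = conjq (t s).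
Proof. by case: s => // s _; rewrite -NegzE. Qed.

Lemma conjq_ext_seq (R : realType) (t : nat -> quat R) (s : int) :
  is_realq (t 0%N) -> conjq (ext_seq t s) = ext_seq t (- s).
Proof.
move=> t0; case: s => [[|s]|s].
- by rewrite /= t0; apply: quatP => /=; rewrite ?oppr0.
- by rewrite ext_seqN.
- by rewrite NegzE opprK /= conjqK.
Qed.

(** The entries of [strang_vec] with natural indices only, so that [lia] can handle them. *)
Definition strang_coef (R : realType) (t : nat -> quat R) (n d : nat) : quat R :=
  if (d <= (n.-1)./2)%N then t d
  else if ~~ odd n && (d == (n.-1)./2.+1) then 0 else conjq (t (n - d)%N).

Lemma strang_vecE (R : realType) (t : nat -> quat R) (n : nat) (d : 'I_n) :
  strang_vec t n d 0 = strang_coef t n d.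
Proof.
rewrite mxE /strang_coef; case: leqP => // _; case: ifP => // _.
by rewrite -opprB subzn 1?ltnW // ext_seqN // subn_gt0.
Qed.

(** With [m = (n.-1)./2], this says [n = 2m + 1] or [n = 2m + 2] according to parity, in a form
    usable by [lia]. *)
Lemma half_predn (n : nat) : (0 < n)%N -> n = ((n.-1)./2.*2 + ~~ odd n).+1.
Proof. by case: n => // n _ /=; rewrite negbK addnC odd_double_half. Qed.

(** At an [n]-th root of unity, the exponent [n - i] amounts to [- i], so the second half of the
    vector supplies the conjugate terms of the partial sum. *)
Lemma circ_symbol_strang (R : realType) (p : quat R) (t : nat -> quat R) (n : nat) (th : R) :
  q0 p = 0 -> p * p = -1 -> (0 < n)%N -> qexp p th ^+ n = 1 ->
  circ_symbol p (strang_vec t n) th = gen_partial p t (n.-1)./2 th.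
Proof.
move=> p0 pp n0 wn; set m := (n.-1)./2.
pose V d := strang_coef t n d * qexp p th ^+ d.
transitivity (\sum_(0 <= d < n) V d).
  by rewrite big_mkord; apply: eq_bigr => d _; rewrite strang_vecE.
have nE := half_predn n0; rewrite -/m in nE.
have mn : (m.+1 <= n)%N by lia.
have wrev i : (i <= n)%N -> qexp p th ^+ (n - i) = qexp p (- (i%:R * th)).
  move=> i_n; rewrite -[RHS]mul1r -wn -{2}(subnK i_n) exprD -mulrA.
  by rewrite -[X in X * qexp _ _]qexpMn // -qexpD // subrr qexp0 // mulr1.
rewrite (big_cat_nat (n := m.+1)) //= big_nat_recl // /gen_partial -addrA; congr (_ + _).
  by rewrite /V /strang_coef leq0n mulr1.
rewrite big_split /= big_mkord; congr (_ + _).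
  by apply: eq_bigr => s _; rewrite /V /strang_coef ltn_ord qexpMn.
rewrite -{1}[m.+1]add0n big_addn big_mkord (reindex_inj rev_ord_inj) /=.
(* The second half is read backwards; for even [n], [i = m] hits the zero entry in the middle. *)
have Vrev i : (i < n - m.+1)%N -> V (n - m.+1 - i.+1 + m.+1)%N =
    (if ~~ odd n && (i == m) then 0 else conjq (t i.+1)) * qexp p (- (i.+1%:R * th)).
  move=> im; have -> : (n - m.+1 - i.+1 + m.+1 = n - i.+1)%N by lia.
  rewrite /V /strang_coef -/m wrev; last by lia.
  have -> : (n - i.+1 <= m)%N = false by lia.
  have -> : ~~ odd n && (n - i.+1 == m.+1)%N = ~~ odd n && (i == m) by lia.
  by rewrite subKn //; lia.
rewrite (eq_bigr _ (fun i _ => Vrev _ (ltn_ord i))).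
have [no|no] := boolP (odd n).
  have -> : (n - m.+1 = m)%N by lia.
  exact: eq_bigr.
have -> : (n - m.+1 = m.+1)%N by lia.
rewrite big_ord_recr /= eqxx mul0r addr0; apply: eq_bigr => i _.
by rewrite ltn_eqF.
Qed.

(** After projection, conjugation exchanges the two terms of each index [s]; the commuting part is
    thus self-conjugate, hence real. *)
Lemma gen_partial_axis (R : realType) (p : quat R) (t : nat -> quat R) (m : nat) (th : R) :
  q0 p = 0 -> p * p = -1 -> is_realq (t 0%N) ->
  axis_comm p (gen_partial p t m th) = qreal (q0 (gen_partial p t m th)).
Proof.
move=> p0 pp t0.
have realP (a : quat R) : conjq a = a -> a = qreal (q0 a).
  by case: a => a0 a1 a2 a3 [h1 h2 h3]; apply: quatP => //=; lra.
rewrite -(q0_axis_comm pp (gen_partial p t m th)); apply: realP.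
rewrite axis_commD axis_comm_sum conjqD conjq_sum; congr (_ + _).
  by rewrite conj_axis_comm // t0; congr axis_comm; apply: quatP; rewrite /= ?oppr0.
have h a y : conjq (axis_comm p (conjq a * qexp p (- y))) = axis_comm p (a * qexp p y).
  rewrite !axis_commM ?qexp_axis // conjqM conj_qexp // opprK -conj_axis_comm // conjqK.
  exact: (qexp_exp_comm y 1 (axis_commP pp a)).
apply: eq_bigr => s _; rewrite axis_commD conjqD addrC; congr (_ + _); first exact: h.
by rewrite -[in LHS]h conjqK.
Qed.

(** * Tails of series and continuity of the generating function *)

Local Open Scope classical_set_scope.
Local Open Scope ring_scope.

Definition tail (R : realType) (b : nat -> R) (m : nat) : R :=
  limn (series b) - series b m.

Lemma tail_cvg0 (R : realType) (b : nat -> R) : cvgn (series b) ->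
  tail b m @[m --> \oo] --> (0 : R).
Proof. by move=> cb; rewrite -(subrr (limn (series b))); apply: cvgB => //; exact: cvg_cst. Qed.

Lemma sum_le_tail (R : realType) (b : nat -> R) (m n : nat) : (forall s, 0 <= b s) ->
  cvgn (series b) -> \sum_(m <= s < n) b s <= tail b m.
Proof.
move=> b0 cb; have [mn|nm] := leqP m n; last first.
  rewrite big_geq ?(ltnW nm) // subr_ge0; apply: nondecreasing_cvgn_le => //.
  by apply: nondecreasing_series.
rewrite -sub_series_geq // lerD2r; apply: nondecreasing_cvgn_le => //.
exact: nondecreasing_series.
Qed.

(** Comparison with [b] makes the series of [a] converge absolutely; the estimate on finite blocks
    then passes to the limit. *)
Lemma series_tail_bound (R : realType) (a b : nat -> R) (K : R) (m : nat) :
  (forall s, `|a s| <= K * b s) -> 0 <= K -> (forall s, 0 <= b s) -> cvgn (series b) ->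
  `|limn (series a) - series a m| <= K * tail b m.
Proof.
move=> ab K0 b0 cb.
have ca : cvgn (series a).
  apply: normed_cvg; apply: (@series_le_cvg _ _ (fun s => K * b s)).
  - by move=> s /=.
  - by move=> s /=; rewrite mulr_ge0.
  - by move=> s; exact: ab.
  - have -> : series (fun s => K * b s) = (fun n => K * series b n).
      by apply/funext => n; rewrite /series /= mulr_sumr.
    by apply: is_cvgM; [exact: is_cvg_cst | exact: cb].
have h : `|series a n - series a m| @[n --> \oo] --> `|limn (series a) - series a m|.
  by apply: cvg_norm; apply: cvgB => //; exact: cvg_cst.
rewrite -(cvg_lim _ h) //; apply: limr_le; first by apply/cvg_ex; eexists; exact: h.
near=> n; have mn : (m <= n)%N by near: n; exact: nbhs_infty_ge.
rewrite sub_series_geq //; apply: le_trans (ler_norm_sum _ _ _) _.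
apply: le_trans (ler_sum _ (fun s _ => ab s)) _.
by rewrite -mulr_sumr ler_wpM2l // sum_le_tail.
Unshelve. all: by end_near. Qed.

Lemma normq_le_coord (R : realType) (a : quat R) :
  normq a <= `|q0 a| + `|q1 a| + `|q2 a| + `|q3 a|.
Proof.
rewrite -ler_sqr ?nnegrE ?normq_ge0 ?addr_ge0 // sqr_normq /dotq -!expr2.
rewrite -(real_normK (num_real (q0 a))) -(real_normK (num_real (q1 a))).
rewrite -(real_normK (num_real (q2 a))) -(real_normK (num_real (q3 a))).
have := normr_ge0 (q0 a); have := normr_ge0 (q1 a).
have := normr_ge0 (q2 a); have := normr_ge0 (q3 a).
move: (`|q0 a|) (`|q1 a|) (`|q2 a|) (`|q3 a|) => x y z w.
move=> w0 z0 y0 x0; have := mulr_ge0 x0 y0; have := mulr_ge0 x0 z0.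
have := mulr_ge0 x0 w0; have := mulr_ge0 y0 z0; have := mulr_ge0 y0 w0.
by have := mulr_ge0 z0 w0; lra.
Qed.

(** Lets one argument treat the four real coordinates. *)
Definition is_coord (R : realType) (c : quat R -> R) : Prop :=
  [\/ c = @q0 R, c = @q1 R, c = @q2 R | c = @q3 R].

Lemma coord_le (R : realType) (c : quat R -> R) (a : quat R) :
  is_coord c -> `|c a| <= normq a.
Proof.
have h (x y z w : R) : `|x| <= Num.sqrt (x ^+ 2 + (y ^+ 2 + z ^+ 2 + w ^+ 2)).
  rewrite -sqrtr_sqr ler_sqrt; first by rewrite lerDl !addr_ge0 ?sqr_ge0.
  by rewrite !addr_ge0 ?sqr_ge0.
case=> ->; rewrite /normq /dotq.
- by apply: le_trans (h _ (q1 a) (q2 a) (q3 a)) (eq_ler _); congr Num.sqrt; ring.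
- by apply: le_trans (h _ (q0 a) (q2 a) (q3 a)) (eq_ler _); congr Num.sqrt; ring.
- by apply: le_trans (h _ (q0 a) (q1 a) (q3 a)) (eq_ler _); congr Num.sqrt; ring.
- by apply: le_trans (h _ (q0 a) (q1 a) (q2 a)) (eq_ler _); congr Num.sqrt; ring.
Qed.

Lemma coordD (R : realType) (c : quat R -> R) (a b : quat R) :
  is_coord c -> c (a + b) = c a + c b.
Proof. by case=> ->. Qed.

Lemma coordB (R : realType) (c : quat R -> R) (a b : quat R) :
  is_coord c -> c (a - b) = c a - c b.
Proof. by case=> ->. Qed.

Lemma coord_sum (R : realType) (c : quat R -> R) (m : nat) (F : nat -> quat R) :
  is_coord c -> c (\sum_(s < m) F s) = series (fun s => c (F s)) m.
Proof.
move=> hc; rewrite /series /= big_mkord; apply: (big_morph c).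
  by move=> a b; exact: coordD.
by case: hc => ->.
Qed.

Lemma coord_series (R : realType) (c : quat R -> R) (u : nat -> quat R) :
  is_coord c -> c (qseries_sum u) = limn (series (fun s => c (u s))).
Proof. by case=> ->. Qed.

Section GeneratingFunction.
Variables (R : realType) (p : quat R) (t : nat -> quat R).
Hypotheses (p0 : q0 p = 0) (pp : p * p = -1) (ht : abs_summable t).

Let f := gen_fun p t.
Let term th (s : nat) := t s.+1 * qexp p (s.+1%:R * th)
  + conjq (t s.+1) * qexp p (- (s.+1%:R * th)).
Let b (s : nat) : R := normq (t s.+1).

Lemma summable_shift : cvgn (series b).
Proof.
pose T s := normq (t s); have cT : cvgn (series T) := ht.
have -> : series b = (fun n => series T n.+1 - T 0%N).
  by apply/funext => n; rewrite /series /= big_nat_recl // addrC addKr.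
apply/cvg_ex; exists (limn (series T) - T 0%N); apply: cvgB; last exact: cvg_cst.
by rewrite (cvg_shiftS (series T)).
Qed.

(** The factor 2 accounts for the term of [t s.+1] and that of its conjugate. *)
Lemma coord_gen_fun (c : quat R -> R) (m : nat) (th : R) : is_coord c ->
  `|c (f th) - c (gen_partial p t m th)| <= 2 * tail b m.
Proof.
move=> hc; rewrite /f /gen_fun /gen_partial !(coordD _ _ hc) opprD addrACA subrr add0r.
rewrite (coord_sum m (term th) hc) coord_series //; apply: series_tail_bound => //.
- move=> s; apply: le_trans (coord_le _ hc) _; apply: le_trans (normqD _ _) _.
  by rewrite !normqM normq_conj !normq_qexp // !mulr1 mulrDl mul1r.
- by move=> s; exact: normq_ge0.
- exact: summable_shift.
Qed.

(** Four coordinates, each off by at most twice the tail. *)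
Lemma normq_gen_fun (m : nat) (th : R) :
  normq (f th - gen_partial p t m th) <= 8 * tail b m.
Proof.
apply: le_trans (normq_le_coord _) _.
have h0 := @coord_gen_fun (@q0 R) m th (Or41 _ _ _ erefl).
have h1 := @coord_gen_fun (@q1 R) m th (Or42 _ _ _ erefl).
have h2 := @coord_gen_fun (@q2 R) m th (Or43 _ _ _ erefl).
have h3 := @coord_gen_fun (@q3 R) m th (Or44 _ _ _ erefl).
rewrite !coordB; [|exact: Or44|exact: Or43|exact: Or42|exact: Or41].
by lra.
Qed.

Lemma continuous_gen_partial (c : quat R -> R) (m : nat) :
  is_coord c -> continuous (fun th => c (gen_partial p t m th)).
Proof.
move=> hc.
have ce (k : R) a : continuous (fun th => c (a * qexp p (k * th))).
  have -> : (fun th => c (a * qexp p (k * th))) =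
      (fun th => cos (k * th) * c a + sin (k * th) * c (a * p)).
    by apply/funext => th; rewrite /qexp; case: hc => -> /=; ring.
  move=> th; have hk : (fun th => k * th) @ th --> k * th.
    by apply: cvgM; [exact: cvg_cst | exact: cvg_id].
  apply: cvgD; apply: cvgM; try exact: cvg_cst.
    by apply: (cvg_comp _ _ hk); exact: continuous_cos.
  by apply: (cvg_comp _ _ hk); exact: continuous_sin.
have -> : (fun th => c (gen_partial p t m th)) = (fun th => c (t 0%N) +
   \sum_(s < m) (c (t s.+1 * qexp p (s.+1%:R * th)) +
                 c (conjq (t s.+1) * qexp p (- s.+1%:R * th)))).
  apply/funext => th; rewrite /gen_partial coordD // (coord_sum m (term th) hc).
  rewrite /series /= big_mkord; congr (_ + _); apply: eq_bigr => s _.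
  by rewrite coordD // mulNr.
move=> th; apply: cvgD; first exact: cvg_cst.
elim: m => [|m IH].
  by under eq_fun => y do rewrite big_ord0; rewrite big_ord0; exact: cvg_cst.
under eq_fun => y do rewrite big_ord_recr.
by rewrite big_ord_recr; apply: cvgD IH _; apply: cvgD; exact: ce.
Qed.

Lemma continuous_gen_fun (c : quat R -> R) :
  is_coord c -> continuous (fun th => c (f th)).
Proof.
move=> hc x; apply/cvgrPdist_lt => e e0.
have t0 := tail_cvg0 summable_shift.
(* The truncation errors at [x] and at [y] are each below [2 * (e / 8)], which leaves [e / 2] for
   the variation of the partial sum. *)
have e8 : 0 < e / 8 by rewrite divr_gt0.
have [m _ /(_ m (leqnn m)) hm] := cvgr_lt 0 t0 (e / 8) e8.
have hc' := @continuous_gen_partial c m hc x.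
have e2 : 0 < e / 2 by rewrite divr_gt0.
near=> y.
have hy : `|c (gen_partial p t m x) - c (gen_partial p t m y)| < e / 2.
  by near: y; move/cvgrPdist_lt: hc'; apply.
have := @coord_gen_fun c m x hc; have := @coord_gen_fun c m y hc.
move: hm hy; rewrite /= !ltr_norml !ler_norml => hm /andP[? ?] /andP[? ?] /andP[? ?].
by apply/andP; split; lra.
Unshelve. all: by end_near. Qed.

End GeneratingFunction.

(** * Coordinates in the imaginary system and the form attached to [check_fun] *)

Lemma imag_system_coord (R : realType) (p q r a : quat R) : imag_system p q r ->
  a = qreal (q0 a) + qreal (dotq a p) * p + qreal (dotq a q) * q + qreal (dotq a r) * r.
Proof.
case=> -[p0 q0' r0] [/normq_eq1 p1 /normq_eq1 q1' /normq_eq1 r1] [pq qr rp] _.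
pose c (u : quat R) (j : 'I_3) := [:: q1 u; q2 u; q3 u]`_j.
pose M : 'M[R]_3 := \matrix_(i, j) c [:: p; q; r]`_i j.
(* Orthonormality of [p], [q], [r] concerns the rows of [M]; expanding [a] requires that of its
   columns. *)
have MM : M *m M^T = 1%:M.
  apply/matrixP => i j; rewrite !mxE !big_ord_recl big_ord0 !mxE /c /=.
  move: p1 q1' r1 pq qr rp; rewrite /dotq p0 q0' r0 => p1 q1' r1 pq qr rp.
  by case: i => -[|[|[|//]]] i3; case: j => -[|[|[|//]]] j3 /=; rewrite ?mulr1n ?mulr0n; lra.
have E i j : \sum_k M k i * M k j = (i == j)%:R.
  have /matrixP/(_ i j) := mulmx1C MM; rewrite !mxE => <-.
  by apply: eq_bigr => k _; rewrite !mxE.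
have e (i j : 'I_3) : c p i * c p j + c q i * c q j + c r i * c r j = (i == j)%:R.
  by rewrite -E !big_ord_recl big_ord0 !mxE /= addr0 addrA.
have E11 := e ord0 ord0; have E12 := e ord0 (lift ord0 ord0).
have E13 := e ord0 ord_max; have E22 := e (lift ord0 ord0) (lift ord0 ord0).
have E23 := e (lift ord0 ord0) ord_max; have E33 := e ord_max ord_max.
move: E11 E12 E13 E22 E23 E33; rewrite /c /= => E11 E12 E13 E22 E23 E33.
apply: quatP => /=; rewrite ?p0 ?q0' ?r0 /dotq.
- by rewrite p0 q0' r0; ring.
- transitivity (q1 a * 1 + q2 a * 0 + q3 a * 0); first by ring.
  by rewrite -[X in q1 a * X]E11 -[X in q2 a * X]E12 -[X in q3 a * X]E13 p0 q0' r0; ring.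
- transitivity (q1 a * 0 + q2 a * 1 + q3 a * 0); first by ring.
  by rewrite -[X in q1 a * X]E12 -[X in q2 a * X]E22 -[X in q3 a * X]E23 p0 q0' r0; ring.
- transitivity (q1 a * 0 + q2 a * 0 + q3 a * 1); first by ring.
  by rewrite -[X in q1 a * X]E13 -[X in q2 a * X]E23 -[X in q3 a * X]E33 p0 q0' r0; ring.
Qed.

(** Conjugation by [p] fixes the span of 1 and [p] and negates that of [q] and [r]. This identifies
    the coupling of opposite frequencies with the [phi2] term of [check_fun]. *)
Lemma axis_anti_phi2 (R : realType) (p q r a : quat R) : imag_system p q r ->
  axis_anti p a = phi2 p q r a * q.
Proof.
move=> h; have [[pp _ _] [[pq qr rp] [qp rq pr]]] := imag_system_table h.
have anti x y : axis_anti p (qreal x + qreal y * p) = 0.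
  have e : (qreal x + qreal y * p) * p = p * (qreal x + qreal y * p).
    by rewrite mulrDl mulrDr (qrealC x p) (mulrA p) -(qrealC y p).
  by rewrite /axis_anti -e -mulrA pp mulrN1 subrr mulr0.
rewrite {1}(imag_system_coord a h) -addrA axis_antiD anti add0r /phi2.
move: (dotq a q) (dotq a r) => u v.
have e : p * (qreal u * q + qreal v * r) * p = qreal u * q + qreal v * r.
  have half x y : p * (qreal x * y) * p = qreal x * (p * y * p).
    by rewrite !mulrA (qrealC x p).
  by rewrite mulrDr mulrDl !half pq rp pr mulNr qp opprK.
rewrite /axis_anti e mulrDl -(mulrA (qreal v)) pq.
by apply: quatP => /=; lra.
Qed.

Lemma normq_axis_anti (R : realType) (p q r a : quat R) : imag_system p q r ->
  normq (axis_anti p a) = normq (phi2 p q r a).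
Proof.
move=> h; rewrite (axis_anti_phi2 _ h) normqM.
by case: h => _ [_ -> _] _ _; rewrite mulr1.
Qed.

Lemma check_funE (R : realType) (p q r : quat R) (f : R -> quat R) (x : R) :
  imag_system p q r -> check_fun p q r f x =
  2^-1 * (q0 (f x) + q0 (f (- x)) - Num.sqrt ((q0 (f x) - q0 (f (- x))) ^+ 2 +
    (dotq (f x) p - dotq (f (- x)) p) ^+ 2 + 4 * normq (phi2 p q r (f x)) ^+ 2)).
Proof.
move=> h; have [[p0 _ _] [/normq_eq1 p1 _ _] _ _] := h.
have q0phi a : q0 (phi1 p a) = q0 a by rewrite /= p0; ring.
rewrite /check_fun !q0phi; congr (_ * (_ - Num.sqrt (_ + _))).
rewrite sqr_normq /phi1; set a := f x; set b := f (- x).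
move: (dotq a p) (dotq b p) => u v.
transitivity ((q0 a - q0 b) ^+ 2 + (u - v) ^+ 2 * dotq p p); last by rewrite p1 mulr1.
by rewrite /dotq /= p0; ring.
Qed.

Lemma sqr_normq_phi2 (R : realType) (p q r a : quat R) : imag_system p q r ->
  normq (phi2 p q r a) ^+ 2 = dotq a q ^+ 2 + dotq a r ^+ 2.
Proof.
move=> h; have [[p0 _ _] [/normq_eq1 p1 _ _] _ _] := h.
rewrite sqr_normq /phi2; move: (dotq a q) (dotq a r) => u v.
transitivity (u ^+ 2 + v ^+ 2 * dotq p p); last by rewrite p1 mulr1.
by rewrite /dotq /= p0; ring.
Qed.

Section CheckFunction.
Variables (R : realType) (p q r : quat R) (t : nat -> quat R).
Hypotheses (hpqr : imag_system p q r) (ht : abs_summable t) (ht0 : is_realq (t 0%N)).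

Let f := gen_fun p t.
Let p0 : q0 p = 0. Proof. by have [[]] := hpqr. Qed.
Let pp : p * p = -1. Proof. by have [[]] := imag_system_table hpqr. Qed.

Lemma continuous_dotq_gen_fun (a : quat R) : continuous (fun x => dotq (f x) a).
Proof.
move=> x; rewrite /dotq; do !apply: cvgD.
all: apply: cvgM; last exact: cvg_cst.
- exact: (continuous_gen_fun p0 pp ht (Or41 _ _ _ erefl)).
- exact: (continuous_gen_fun p0 pp ht (Or42 _ _ _ erefl)).
- exact: (continuous_gen_fun p0 pp ht (Or43 _ _ _ erefl)).
- exact: (continuous_gen_fun p0 pp ht (Or44 _ _ _ erefl)).
Qed.

Lemma continuous_check_fun : continuous (check_fun p q r f).
Proof.
have cq0 : continuous (fun x => q0 (f x)).
  exact: (continuous_gen_fun p0 pp ht (Or41 _ _ _ erefl)).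
have cN (g : R -> R) : continuous g -> continuous (fun x => g (- x)).
  move=> cg x; apply: (@cvg_comp _ _ _ (fun y : R => - y) g _ (nbhs (- x))); last exact: cg.
  by apply: cvgN; exact: cvg_id.
have -> : check_fun p q r f = (fun x => 2^-1 * (q0 (f x) + q0 (f (- x)) -
    Num.sqrt ((q0 (f x) - q0 (f (- x))) ^+ 2 +
    (dotq (f x) p - dotq (f (- x)) p) ^+ 2 +
    4 * (dotq (f x) q ^+ 2 + dotq (f x) r ^+ 2)))).
  by apply/funext => x; rewrite check_funE // sqr_normq_phi2.
have cd a := @continuous_dotq_gen_fun a.
have csq (g : R -> R) : continuous g -> continuous (fun x => g x ^+ 2).
  by move=> cg x; exact: (cvgM (cg x) (cg x)).
move=> x; apply: cvgM; first exact: cvg_cst.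
apply: cvgB; first by apply: cvgD; [exact: cq0 | exact: (cN _ cq0)].
apply: continuous_comp; last exact: sqrt_continuous.
have c1 : continuous (fun x => q0 (f x) - q0 (f (- x))).
  by move=> y; apply: cvgB; [exact: cq0 | exact: (cN _ cq0)].
have c2 : continuous (fun x => dotq (f x) p - dotq (f (- x)) p).
  by move=> y; apply: cvgB; [exact: cd | exact: (cN _ (cd p))].
apply: cvgD; first by apply: cvgD; [exact: (csq _ c1) | exact: (csq _ c2)].
apply: cvgM; first exact: cvg_cst.
by apply: cvgD; [exact: (csq _ (cd q)) | exact: (csq _ (cd r))].
Qed.

(** Nonnegative trace and determinant make the symmetric matrix with diagonal [A], [B] and
    off-diagonal entry [- c] positive semidefinite. *)
Lemma quadratic_form_ge (A B c a b : R) : 0 <= A + B -> c ^+ 2 <= A * B ->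
  0 <= c -> 0 <= a -> 0 <= b -> 2 * c * (a * b) <= A * a ^+ 2 + B * b ^+ 2.
Proof.
move=> AB cAB c0 a0 b0.
have [A0 B0] : 0 <= A /\ 0 <= B.
  have := sqr_ge0 c; split; nra.
have h : 0 <= A * a ^+ 2 + B * b ^+ 2 by rewrite addr_ge0 ?mulr_ge0 ?sqr_ge0.
rewrite -ler_sqr ?nnegrE ?mulr_ge0 //.
have h2 := ler_wpM2r (sqr_ge0 (a * b)) cAB.
have h3 := sqr_ge0 (A * a ^+ 2 - B * b ^+ 2).
by nra.
Qed.

(** Let [u], [v] be the values of [q0 (f _)] at [x] and [- x], [c] the coupling and [m] the value of
    [check_fun]. The square root is [s = u + v - 2 m], and [4 (u - m) (v - m) = s^2 - (u - v)^2 >= 4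
    c^2], so the form shifted by [m] has nonnegative trace and determinant. *)
Lemma check_fun_form (x a b : R) : 0 <= a -> 0 <= b ->
  check_fun p q r f x * (a ^+ 2 + b ^+ 2) <=
  q0 (f x) * a ^+ 2 + q0 (f (- x)) * b ^+ 2 - 2 * normq (axis_anti p (f x)) * (a * b).
Proof.
move=> a0 b0; rewrite (normq_axis_anti _ hpqr).
set m := check_fun _ _ _ _ _; set c := normq _.
have := check_funE f x hpqr; rewrite -/m -/c.
set D := _ + _ + 4 * _; move=> mE.
have c0 : 0 <= c := normq_ge0 _.
have D0 : 0 <= D by rewrite !addr_ge0 ?sqr_ge0 ?mulr_ge0 ?sqr_ge0.
have sD := sqr_sqrtr D0; have s0 := sqrtr_ge0 D.
move: mE sD s0; rewrite /D; set s := Num.sqrt _.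
move: (q0 (f x)) (q0 (f (- x))) => u v; clearbody s m c => mE sD s0.
have sE : s = u + v - 2 * m by rewrite mE; lra.
have AB : 0 <= (u - m) + (v - m) by rewrite sE in s0; lra.
have cAB : c ^+ 2 <= (u - m) * (v - m).
  by have := sqr_ge0 (dotq (f x) p - dotq (f (- x)) p); rewrite sE in sD; nra.
by have := quadratic_form_ge AB cAB c0 a0 b0; lra.
Qed.

End CheckFunction.

(** * Uniform coercivity of the Strang matrices *)

Lemma normq_axis_anti_le (R : realType) (p a : quat R) :
  normq p = 1 -> normq (axis_anti p a) <= normq a.
Proof.
move=> p1; rewrite normqM normq_real ger0_norm ?invr_ge0 //.
have := normqD a (p * a * p); rewrite !normqM p1 mul1r mulr1; lra.
Qed.

(** [acos (cos th)] has the right cosine and, up to a change of sign, the right sine. *)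
Lemma qexp_reduce (R : realType) (p : quat R) (th : R) :
  exists2 th' : R, - pi <= th' <= pi & qexp p th' = qexp p th.
Proof.
have c1 : -1 <= cos th <= 1 by rewrite cos_geN1 cos_le1.
have ac : cos (acos (cos th)) = cos th by rewrite acosK // in_itv.
have as_ : sin (acos (cos th)) ^+ 2 = sin th ^+ 2 by rewrite !sin2cos2 ac.
have a0 := acos_ge0 c1; have api := acos_lepi c1.
move/eqP: as_; rewrite eqf_sqr => /orP[]/eqP h.
  by exists (acos (cos th)); rewrite /qexp ?ac ?h //; lra.
exists (- acos (cos th)); first by lra.
by rewrite /qexp cosN sinN ac h opprK.
Qed.

Lemma strang_coercive (R : realType) (p q r : quat R) (t : nat -> quat R) :
  imag_system p q r -> abs_summable t -> is_realq (t 0%N) ->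
  (forall x : R, - pi <= x <= pi -> 0 < check_fun p q r (gen_fun p t) x) ->
  exists (delta : R) (M : nat), 0 < delta /\
    forall n (x : 'cV[quat R]_n), (0 < n)%N -> (M <= (n.-1)./2)%N ->
      delta * dotv x x <= dotv x (strang t n *m x).
Proof.
move=> hpqr ht ht0 hf.
have p0 : q0 p = 0 by have [[]] := hpqr.
have p1 : normq p = 1 by have [_ []] := hpqr.
have pp : p * p = -1 by have [[]] := imag_system_table hpqr.
have pi0 := pi_gt0 R; have pipi : - pi <= pi :> R by lra.
have [c cpi cmin] := EVT_min pipi
  (continuous_subspaceT (continuous_check_fun hpqr ht)).
set d0 := check_fun _ _ _ _ c in cmin.
have d00 : 0 < d0 by apply: hf; move: cpi; rewrite in_itv.
have chk x : - pi <= x <= pi -> d0 <= check_fun p q r (gen_fun p t) x.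
  by move=> hx; apply: cmin; rewrite in_itv.
(* The factor 8 of [normq_gen_fun] turns this into an approximation within [d0 / 4]. *)
have e0 : 0 < d0 / 32 by rewrite divr_gt0.
have [M _ hM] := cvgr_lt 0 (tail_cvg0 (summable_shift ht)) (d0 / 32) e0.
(* Perturbing two diagonal terms and two couplings by [d0 / 4] costs at most [d0 / 4] times
   [a^2 + b^2 + 2 a b], hence half of [d0 * (a^2 + b^2)]. *)
exists (d0 / 2), M; split=> [|n x n0 Mn]; first by rewrite divr_gt0.
have := hM _ Mn; rewrite /=; set m := (n.-1)./2; set e := tail _ _ => he.
have approx th : normq (gen_fun p t th - gen_partial p t m th) <= d0 / 4.
  by apply: le_trans (normq_gen_fun p0 pp ht m th) _; rewrite -/e; lra.
have q0_approx th : q0 (gen_fun p t th) - d0 / 4 <= q0 (gen_partial p t m th).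
  have := le_trans (ler_norm _) (le_trans (normr_q0 _) (approx th)).
  by rewrite q0B; lra.
have anti_approx th : normq (axis_anti p (gen_partial p t m th)) <=
    normq (axis_anti p (gen_fun p t th)) + d0 / 4.
  have -> : gen_partial p t m th = gen_fun p t th + - (gen_fun p t th - gen_partial p t m th).
    by rewrite opprB addrC subrK.
  rewrite axis_antiD; apply: le_trans (normqD _ _) _; rewrite lerD2l.
  by apply: le_trans (normq_axis_anti_le _ p1) _; rewrite normqN.
have conjE th : qexp p (- th) = conjq (qexp p th) by rewrite conj_qexp.
have rootN th : qexp p th ^+ n = 1 -> qexp p (- th) ^+ n = 1.
  move=> wn; have h : qexp p (n%:R * th) = 1 by rewrite qexpMn.
  by rewrite -qexpMn // mulrN conjE h; apply: quatP; rewrite /= ?oppr0.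
apply: (circulant_coercive p0 pp) => // [th wn|th a b wn a0 b0].
  by rewrite circ_symbol_strang // gen_partial_axis.
have [y hy yE] := qexp_reduce p th.
have -> : circ_symbol p (strang_vec t n) th = circ_symbol p (strang_vec t n) y.
  by rewrite /circ_symbol yE.
have -> : circ_symbol p (strang_vec t n) (- th) = circ_symbol p (strang_vec t n) (- y).
  by rewrite /circ_symbol !conjE yE.
have wy : qexp p y ^+ n = 1 by rewrite yE.
rewrite !circ_symbol_strang ?rootN // -/m.
have hyN : - pi <= - y <= pi by lra.
(* The mean of the bounds at [y] and [- y] produces the sum of the two couplings expected by
   [circulant_coercive]. *)
have f1 := check_fun_form t hpqr y a0 b0; have f2 := check_fun_form t hpqr (- y) b0 a0.
rewrite opprK in f2.
have ab2 : 0 <= a ^+ 2 + b ^+ 2 by rewrite addr_ge0 ?sqr_ge0.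
have g1 := le_trans (ler_wpM2r ab2 (chk y hy)) f1.
have ba2 : 0 <= b ^+ 2 + a ^+ 2 by rewrite addrC.
have g2 := le_trans (ler_wpM2r ba2 (chk _ hyN)) f2.
have := q0_approx y; have := q0_approx (- y).
have := anti_approx y; have := anti_approx (- y).
move: f1 f2 g1 g2 => _ _.
move: (q0 (gen_fun p t y)) (q0 (gen_fun p t (- y))) (q0 (gen_partial p t m y))
  (q0 (gen_partial p t m (- y))) (normq (axis_anti p (gen_fun p t y)))
  (normq (axis_anti p (gen_fun p t (- y)))) (normq (axis_anti p (gen_partial p t m y)))
  (normq (axis_anti p (gen_partial p t m (- y)))) => u v U V k l K L g1 g2 hL hK hV hU.
have A1 := ler_wpM2r (sqr_ge0 a) hU; have B1 := ler_wpM2r (sqr_ge0 b) hV.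
have ab0 : 0 <= a * b := mulr_ge0 a0 b0.
have K1 := ler_wpM2r ab0 hK; have L1 := ler_wpM2r ab0 hL.
have sq : 2 * (a * b) <= a ^+ 2 + b ^+ 2 by have := sqr_ge0 (a - b); nra.
by have := ler_wpM2l (ltW d00) sq; nra.
Qed.

(** * Comparison of Toeplitz and Strang matrices *)

(** For even [n] the middle index is its own mirror image, which is consistent because its entry is
    0. *)
Lemma conj_strang_coef (R : realType) (t : nat -> quat R) (n d : nat) :
  (0 < d < n)%N -> conjq (strang_coef t n (n - d)) = strang_coef t n d.
Proof.
move=> /andP[d0 dn]; have := half_predn (leq_ltn_trans (leq0n d) dn).
rewrite /strang_coef; set m := (n.-1)./2 => nE.
have [dm|md] := leqP d m.
  have -> : (n - d <= m)%N = false by lia.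
  have -> : ~~ odd n && (n - d == m.+1)%N = false by lia.
  by rewrite conjqK subKn // ltnW.
have [e|/negbTE e] := boolP (~~ odd n && (d == m.+1)).
  have -> : (n - d <= m)%N = false by lia.
  have -> : ~~ odd n && (n - d == m.+1)%N = true by lia.
  by apply: quatP; rewrite /= ?oppr0.
by have -> : (n - d <= m)%N = true by lia.
Qed.

Lemma strangE (R : realType) (t : nat -> quat R) (n : nat) (j l : 'I_n) :
  strang t n j l = strang_coef t n (if (l <= j)%N then j - l else n - (l - j))%N.
Proof.
rewrite mxE strang_vecE /=; congr strang_coef.
have jn := ltn_ord j; have ln := ltn_ord l.
case: leqP => lj; last by rewrite modn_small; lia.
by rewrite (_ : j + (n - l) = (j - l) + n)%N ?modnDr ?modn_small; lia.
Qed.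

Lemma toeplitzE (R : realType) (t : nat -> quat R) (n : nat) (j l : 'I_n) :
  toeplitz t n j l = if (l <= j)%N then t (j - l)%N else conjq (t (l - j)%N).
Proof.
rewrite mxE; case: leqP => lj; first by rewrite subzn.
by rewrite -opprB subzn 1?ltnW // ext_seqN // subn_gt0.
Qed.

Lemma toeplitz_hermitian (R : realType) (t : nat -> quat R) (n : nat) :
  is_realq (t 0%N) -> hermitianq (toeplitz t n).
Proof.
by move=> t0; apply/matrixP => i j; rewrite !mxE conjq_ext_seq // opprB.
Qed.

Lemma strang_hermitian (R : realType) (t : nat -> quat R) (n : nat) :
  is_realq (t 0%N) -> hermitianq (strang t n).
Proof.
move=> t0; apply/matrixP => i j; rewrite mxE !strangE.
have ni := ltn_ord i; have nj := ltn_ord j.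
case: (ltngtP i j) => ij.
- by rewrite -[RHS]conj_strang_coef ?subKn //; lia.
- by rewrite conj_strang_coef //; lia.
- rewrite -ij subnn /strang_coef leq0n t0.
  by apply: quatP; rewrite /= ?oppr0.
Qed.

(** The distance to the diagonal; truncation makes one of the two summands zero. *)
Definition absdiff (j l : nat) : nat := ((j - l) + (l - j))%N.

Lemma strang_near (R : realType) (t : nat -> quat R) (n : nat) (j l : 'I_n) :
  (absdiff j l <= (n.-1)./2)%N -> strang t n j l = toeplitz t n j l.
Proof.
rewrite strangE toeplitzE /absdiff => jl.
have nE := half_predn (leq_ltn_trans (leq0n j) (ltn_ord j)).
have nj := ltn_ord j; have nl := ltn_ord l.
case: leqP => lj; rewrite /strang_coef.
  by have -> : (j - l <= n.-1./2)%N by lia.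
have -> : (n - (l - j) <= n.-1./2)%N = false by lia.
have -> : ~~ odd n && (n - (l - j) == n.-1./2.+1)%N = false by lia.
by rewrite subKn //; lia.
Qed.

Lemma normq_toeplitz (R : realType) (t : nat -> quat R) (n : nat) (j l : 'I_n) :
  normq (toeplitz t n j l) = normq (t (absdiff j l)).
Proof.
rewrite toeplitzE /absdiff; case: leqP => lj.
  by congr (normq (t _)); lia.
by rewrite normq_conj; congr (normq (t _)); lia.
Qed.

Lemma strang_far (R : realType) (t : nat -> quat R) (n : nat) (j l : 'I_n) :
  ((n.-1)./2 < absdiff j l)%N -> normq (strang t n j l) <= normq (t (n - absdiff j l)%N).
Proof.
rewrite strangE /absdiff => jl.
have nE := half_predn (leq_ltn_trans (leq0n j) (ltn_ord j)).
have nj := ltn_ord j; have nl := ltn_ord l.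
rewrite /strang_coef; case: (leqP l j) => lj.
  have -> : (j - l <= n.-1./2)%N = false by lia.
  case: ifP => _; first by rewrite normq0 normq_ge0.
  by rewrite normq_conj; have -> : (j - l + (l - j) = j - l)%N by lia.
have -> : (j - l + (l - j) = l - j)%N by lia.
case: leqP => h1 //; case: ifP => h2; first by rewrite normq0 normq_ge0.
lia.
Qed.

(** Schur's test: each row has absolute sum at most [2 * K], once [K] for either side of the
    diagonal, and products of entries of [x] are bounded by half sums of squares. *)
Lemma dotv_mulmx_le (R : realType) (n : nat) (M : 'M[quat R]_n) (g : nat -> R) (K : R)
    (x : 'cV[quat R]_n) :
  (forall s, 0 <= g s) ->
  (forall j l : 'I_n, normq (M j l) <= g (absdiff j l)) ->
  \sum_(s < n) g s <= K -> `|dotv x (M *m x)| <= 2 * K * dotv x x.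
Proof.
move=> g0 Mg gK.
have row (j : 'I_n) : \sum_(l < n) g (absdiff j l) <= 2 * K.
  have part k : (k <= n)%N -> \sum_(0 <= s < k) g s <= K.
    move=> kn; apply: le_trans gK.
    rewrite -(big_mkord predT) [leRHS](big_cat_nat (n := k)) //=.
    by rewrite lerDl sumr_ge0.
  rewrite -(big_mkord predT (fun l => g (absdiff j l))) (big_cat_nat (n := j.+1)) //=.
  rewrite mulrDl mul1r lerD //.
    rewrite big_nat_rev /= add0n; apply: le_trans (part j.+1 _) => //.
    by apply/eq_ler/eq_big_nat => i ij; congr g; rewrite /absdiff; lia.
  rewrite -{1}[j.+1]add0n big_addn.
  apply: le_trans (part (n - j)%N (leq_subr _ _)).
  (* Right of the diagonal the distances start at 1; adding [g 0] only enlarges the sum. *)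
  have -> : (n - j = (n - j.+1).+1)%N by have := ltn_ord j; lia.
  rewrite big_nat_recl // ler_wpDl //.
  by apply/eq_ler/eq_big_nat => i ij; congr g; rewrite /absdiff; lia.
pose w (j : 'I_n) := normq (x j 0).
have xx : dotv x x = \sum_j w j ^+ 2 by apply: eq_bigr => j _; rewrite sqr_normq.
have bound : `|dotv x (M *m x)| <=
    \sum_(j < n) \sum_(l < n) g (absdiff j l) * ((w j ^+ 2 + w l ^+ 2) / 2).
  apply: le_trans (ler_norm_sum _ _ _) _; apply: ler_sum => j _.
  rewrite mxE dotqE mulr_sumr q0_sum; apply: le_trans (ler_norm_sum _ _ _) _.
  apply: ler_sum => l _; apply: le_trans (normr_q0 _) _.
  rewrite !normqM normq_conj mulrCA.
  apply: ler_pM; rewrite ?mulr_ge0 ?normq_ge0 //.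
  have := sqr_ge0 (w j - w l); rewrite /w; lra.
apply: le_trans bound _.
rewrite (_ : \sum_(j < n) _ = (\sum_(j < n) \sum_(l < n) g (absdiff j l) * (w j ^+ 2 / 2)) +
                        (\sum_(j < n) \sum_(l < n) g (absdiff j l) * (w l ^+ 2 / 2))); last first.
  by rewrite -big_split; apply: eq_bigr => j _; rewrite -big_split; apply: eq_bigr => l _ /=; ring.
have half (e : 'I_n -> 'I_n -> nat) : (forall j : 'I_n, \sum_(l < n) g (e j l) <= 2 * K) ->
    \sum_(j < n) \sum_(l < n) g (e j l) * (w j ^+ 2 / 2) <= K * dotv x x.
  move=> he; rewrite xx mulr_sumr; apply: ler_sum => j _.
  rewrite -mulr_suml; have := ler_wpM2r (sqr_ge0 (w j)) (he j); lra.
rewrite mulrDl mul1r mulrDl lerD //; first exact: half.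
rewrite exchange_big /=; apply: (half (fun j l : 'I_n => absdiff l j)) => j.
by rewrite (eq_bigr (fun l : 'I_n => g (absdiff j l))) // => l _; rewrite /absdiff addnC.
Qed.

Lemma sum_le_tail_ord (R : realType) (b : nat -> R) (N n : nat) : (forall s, 0 <= b s) ->
  cvgn (series b) -> \sum_(s < n) (if (N <= s)%N then b s else 0) <= tail b N.
Proof. move=> b0 cb; apply: le_trans (sum_le_tail N n b0 cb).
by rewrite big_geq_mkord [leRHS]big_mkcond. Qed.

Lemma tail_ge0 (R : realType) (b : nat -> R) (N : nat) : (forall s, 0 <= b s) ->
  cvgn (series b) -> 0 <= tail b N.
Proof.
by move=> b0 cb; apply: le_trans (sum_le_tail_ord N 0 b0 cb); rewrite big_ord0.
Qed.

(** Padding by zeros to size [2n + 1]: half of [2n] is [n], so all index differences below [n] fall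
    where the Strang and Toeplitz entries agree. *)
Lemma toeplitz_principal (R : realType) (t : nat -> quat R) (n : nat) (x : 'cV[quat R]_n) :
  exists x' : 'cV[quat R]_(n + n.+1), dotv x' x' = dotv x x /\
    dotv x' (strang t (n + n.+1) *m x') = dotv x (toeplitz t n *m x).
Proof.
pose x' : 'cV[quat R]_(n + n.+1) := col_mx x 0; exists x'.
split; rewrite /dotv big_split_ord /= [X in _ + X]big1 ?addr0.
- by apply: eq_bigr => i _; rewrite col_mxEu.
- by move=> i _; rewrite col_mxEd mxE dot0q.
- apply: eq_bigr => i _; rewrite col_mxEu; congr dotq.
  rewrite [LHS]mxE [RHS]mxE big_split_ord /=.
  rewrite [X in _ + X]big1 ?addr0 => [|l _]; last by rewrite col_mxEd [X in _ * X]mxE mulr0.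
  apply: eq_bigr => l _; rewrite col_mxEu; congr (_ * _).
  rewrite strang_near ?toeplitzE //.
  by have := ltn_ord i; have := ltn_ord l; rewrite /absdiff /=; lia.
- by move=> i _; rewrite col_mxEd mxE dot0q.
Qed.

(** * Uniform upper bounds and closeness away from the first coordinates *)

Section Bounds.
Variables (R : realType) (t : nat -> quat R).
Hypotheses (ht : abs_summable t) (ht0 : is_realq (t 0%N)).

Let T s := normq (t s).
Let b s := normq (t s.+1).
Let T0 s : 0 <= T s. Proof. exact: normq_ge0. Qed.
Let b0 s : 0 <= b s. Proof. exact: normq_ge0. Qed.
Let cT : cvgn (series T) := ht.
Let cb : cvgn (series b) := summable_shift ht.

Lemma sum_rev_le_tail (N n : nat) :
  \sum_(s < n) (if (s < n - N)%N then T (n - s) else 0) <= tail b N.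
Proof.
rewrite (reindex_inj rev_ord_inj) /=; apply: le_trans (sum_le_tail_ord N n b0 cb).
apply/eq_ler/eq_bigr => s _.
have sn := ltn_ord s; rewrite (_ : n - (n - s.+1) = s.+1)%N; last by lia.
by rewrite (_ : (n - s.+1 < n - N)%N = (N <= s)%N) //; lia.
Qed.

Lemma toeplitz_bounded (n : nat) (x : 'cV[quat R]_n) :
  dotv x (toeplitz t n *m x) <= 2 * (tail T 0 + tail b 0) * dotv x x.
Proof.
apply: le_trans (ler_norm _) _; apply: (dotv_mulmx_le x T0).
  by move=> j l; rewrite normq_toeplitz.
apply: le_trans (sum_le_tail_ord 0 n T0 cT) _; rewrite lerDl.
exact: tail_ge0.
Qed.

Lemma strang_bounded (n : nat) (x : 'cV[quat R]_n) :
  dotv x (strang t n *m x) <= 2 * (tail T 0 + tail b 0) * dotv x x.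
Proof.
apply: le_trans (ler_norm _) _.
(* An entry at distance [s] is the Toeplitz one or a wrapped one of index [n - s] (or 0); [g]
   dominates all cases. *)
pose g s := T s + (if (s < n - 0)%N then T (n - s) else 0).
apply: (@dotv_mulmx_le _ _ _ g).
- by move=> s; rewrite /g addr_ge0 //; case: ifP.
- move=> j l; rewrite /g.
  have -> : (absdiff j l < n - 0)%N.
    by have := ltn_ord j; have := ltn_ord l; rewrite /absdiff; lia.
  have [h|h] := leqP (absdiff j l) (n.-1)./2.
    by rewrite strang_near // normq_toeplitz lerDl.
  by apply: le_trans (strang_far _ h) _; rewrite lerDr.
rewrite /g big_split lerD //; last exact: sum_rev_le_tail.
exact: (sum_le_tail_ord 0 n T0 cT).
Qed.

(** The matrices differ only at distances above [(n.-1)./2], hence above [N]; and indices that are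
    both at least [N] are at distance below [n - N]. So only coefficients of index above [N]
    contribute, direct or wrapped. *)
Lemma toeplitz_strang_close (n N : nat) (x : 'cV[quat R]_n) : (N <= (n.-1)./2)%N ->
  (forall j : 'I_n, (j < N)%N -> x j 0 = 0) ->
  `|dotv x (toeplitz t n *m x) - dotv x (strang t n *m x)| <=
  2 * (tail T N + tail b N) * dotv x x.
Proof.
move=> Nm x0; rewrite -dotvBr -mulmxBl.
(* Rows and columns below [N] are cut out, as [x] vanishes there. *)
pose D : 'M[quat R]_n := \matrix_(j, l)
  if (N <= j)%N && (N <= l)%N then toeplitz t n j l - strang t n j l else 0.
have -> : dotv x ((toeplitz t n - strang t n) *m x) = dotv x (D *m x).
  apply: eq_bigr => j _; have [jN|Nj] := ltnP j N.
    by rewrite x0 // !dot0q.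
  rewrite !mxE; congr dotq; apply: eq_bigr => l _; rewrite [D j l]mxE Nj /=.
  by case: leqP => [_|lN]; [rewrite !mxE | rewrite x0 // !mulr0].
pose g s := (if (N <= s)%N then T s else 0) + (if (s < n - N)%N then T (n - s) else 0).
apply: (@dotv_mulmx_le _ _ _ g).
- by move=> s; rewrite /g addr_ge0 //; case: ifP.
- move=> j l; have [h|h] := leqP (absdiff j l) (n.-1)./2.
    rewrite mxE strang_near // subrr if_same normq0.
    by rewrite /g addr_ge0 //; case: ifP.
  rewrite mxE; case: ifP => [/andP[Nj Nl]|_]; last first.
    by rewrite normq0 /g addr_ge0 //; case: ifP.
  have -> : g (absdiff j l) = T (absdiff j l) + T (n - absdiff j l)%N.
    rewrite /g (leq_trans Nm (ltnW h)).
    have -> // : (absdiff j l < n - N)%N.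
    by have := ltn_ord j; have := ltn_ord l; rewrite /absdiff; lia.
  apply: le_trans (normqD _ _) _; rewrite normqN normq_toeplitz lerD2l.
  exact: strang_far.
rewrite /g big_split lerD //; last exact: sum_rev_le_tail.
exact: sum_le_tail_ord.
Qed.

End Bounds.

(** * Choice of the constants and conclusion *)

Theorem theorem3p6 (R : realType) (p q r : quat R) (t : nat -> quat R)
  (hpqr : imag_system p q r)
  (ht : abs_summable t)
  (ht0 : is_realq (t 0%N))
  (hf : forall x : R, - pi <= x <= pi -> 0 < check_fun p q r (gen_fun p t) x)
  (eps : R) (heps : 0 < eps < 1) :
  exists (C : R) (n0 : nat),
    [/\ 0 < C, (0 < n0)%N &
      forall n : nat, (n0 < n)%N ->
        [/\ hpd (toeplitz t n), hpd (strang t n) &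
          forall (b u0 u : 'cV[quat R]_n), toeplitz t n *m u = b ->
          forall k : nat, (4 * n0 <= k)%N ->
            normA (toeplitz t n)
                  (pcg_iter (toeplitz t n) (strang t n) b u0 k - u)
            <= C * eps ^+ (k - 4 * n0)
               * normA (toeplitz t n) (u0 - u)]].
Proof.
have /andP[eps0 eps1] := heps.
have [delta [M [d0 hP]]] := strang_coercive hpqr ht ht0 hf.
pose T s := normq (t s); pose b s := normq (t s.+1).
(* An upper bound of both forms; the summand 1 ensures [0 < K]. *)
pose K := 2 * (tail T 0 + tail b 0) + 1.
have T0 s : 0 <= T s by exact: normq_ge0.
have b0 s : 0 <= b s by exact: normq_ge0.
have cT : cvgn (series T) := ht.
have cb : cvgn (series b) := summable_shift ht.
have K0 : 0 < K.
  by rewrite ltr_wpDl // mulr_ge0 // addr_ge0 // tail_ge0.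
(* Two such tails, doubled, stay below [eps * delta], which coercivity converts into [eps] times the
   form of the preconditioner. *)
have e4 : 0 < eps * delta / 4 by rewrite divr_gt0 // mulr_gt0.
have [N1 _ hN1] := cvgr_lt 0 (tail_cvg0 cT) _ e4.
have [N2 _ hN2] := cvgr_lt 0 (tail_cvg0 cb) _ e4.
pose N := maxn N1 N2.
have hN : 2 * (tail T N + tail b N) <= eps * delta.
  have := hN1 N (leq_maxl _ _); have := hN2 N (leq_maxr _ _); rewrite /=; lra.
(* Both forms lie between [delta] and [K] times the squared norm, so the pencil has its eigenvalues
   between [delta / K] and [K / delta]. *)
pose C := (1 + K / delta / (delta / K)) ^+ (4 * N).
have C1 : 1 <= 1 + K / delta / (delta / K).
  by rewrite lerDl !divr_ge0 ?ltW // divr_gt0.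
(* For larger [n], [(n.-1)./2] is at least [N] and [M]. *)
exists C, (maxn N M).*2.+2; split=> //; first by rewrite exprn_gt0 // (lt_le_trans ltr01).
move=> n n0n; have mN : (N <= (n.-1)./2)%N by lia.
have mM : (M <= (n.-1)./2)%N by lia.
have Pge (x : 'cV[quat R]_n) : delta * dotv x x <= dotv x (strang t n *m x).
  by apply: hP => //; lia.
have Age (x : 'cV[quat R]_n) : delta * dotv x x <= dotv x (toeplitz t n *m x).
  by have [x' [<- <-]] := toeplitz_principal t x; apply: hP; lia.
have hA : hpd (toeplitz t n).
  split=> [|x x0]; first exact: toeplitz_hermitian.
  by rewrite q0_qform (lt_le_trans _ (Age x)) // mulr_gt0 // dotv_gt0.
have hPP : hpd (strang t n).
  split=> [|x x0]; first exact: strang_hermitian.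
  by rewrite q0_qform (lt_le_trans _ (Pge x)) // mulr_gt0 // dotv_gt0.
split=> // bb u0 u Au k kn0.
have Nn : (N <= n)%N by lia.
pose Z : {set 'I_n} := [set widen_ord Nn i | i in 'I_N]%SET.
have ZN : (#|Z| <= N)%N by rewrite (leq_trans (leq_imset_card _ _)) // card_ord.
have le_K y : 0 <= y -> 2 * (tail T 0 + tail b 0) * y <= K * y.
  by move=> y0; rewrite ler_wpM2r // lerDl.
have hlo : 0 < delta / K by rewrite divr_gt0.
have hhi : 0 <= K / delta by rewrite divr_ge0 // ltW.
have APs (x : 'cV[quat R]_n) :
    delta / K * dotv x (strang t n *m x) <= dotv x (toeplitz t n *m x) <=
    K / delta * dotv x (strang t n *m x).
  have x0 := dotv_ge0 x; apply/andP; split.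
    apply: le_trans (Age x); rewrite -mulrA ler_wpM2l ?(ltW d0) // mulrC ler_pdivrMr //.
    by rewrite mulrC; apply: le_trans (strang_bounded ht x) (le_K _ x0).
  apply: le_trans (toeplitz_bounded ht x) _; apply: le_trans (le_K _ x0) _.
  by rewrite -mulrA ler_wpM2l ?(ltW K0) // ler_pdivlMl.
have APc (x : 'cV[quat R]_n) : (forall j, j \in Z -> x j 0 = 0) ->
    `|dotv x (toeplitz t n *m x) - dotv x (strang t n *m x)| <=
    eps * dotv x (strang t n *m x).
  move=> xZ; apply: le_trans (toeplitz_strang_close ht mN _) _ => [j jN|].
    apply: xZ; apply/imsetP; exists (Ordinal jN) => //; exact: val_inj.
  apply: le_trans (ler_wpM2r (dotv_ge0 x) hN) _.
  by rewrite -mulrA ler_wpM2l // ltW.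
have Zn0 : (#|Z| <= (maxn N M).*2.+2)%N.
  by rewrite -addnn !leqW // (leq_trans ZN) // (leq_trans (leq_maxl N M)) // leq_addr.
have kZ : (4 * #|Z| <= k)%N by rewrite (leq_trans _ kn0) // leq_mul2l.
apply: le_trans (pcg_cluster hA hPP hlo hhi (ltW eps0) APs APc u0 Au kZ) _.
apply: ler_wpM2r; first exact: sqrtr_ge0.
(* The exponents in [#|Z|] are relaxed: to [N] in the first factor, whose base is at least 1, and to
   the chosen threshold in the second, as [eps < 1]. *)
apply: ler_pM; rewrite ?exprn_ge0 ?(ltW eps0) // ?(le_trans ler01) //.
  by rewrite ler_weXn2l // leq_mul2l.
by rewrite ler_wiXn2l ?ltW // leq_sub2l // leq_mul2l.
Qed.
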